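(* Consider the problem $\min_{x\in\mathbb{R}^{d_x}}\max_{y\in\mathbb{R}^{d_y}} r(x)+F(x,y)-g(y)$ under the assumptions stated in the context, and Algorithm FOAM described in the context. Let the parameters of FOAM be $$\theta_y = 8\mu_x^{-1},\quad \alpha=\min\{1,\sqrt{\theta_y\mu_y}\},\quad \lambda=\left(2\sqrt5\,(1+8L/\mu_x)\right)^{-1},\quad \gamma_x=8\mu_x^{-1},\quad \gamma_y=\theta_y,$$ $$\eta_z=\frac{\mu_x}{2},\quad \eta_y=\min\left\{\frac{1}{2\mu_y},\frac{\theta_y}{2\alpha}\right\},\quad \beta_t=\frac{2}{t+3}\ \ (t=0,1,2,\ldots).$$ Then, to find an $\epsilon$-accurate solution of the problem, FOAM requires the following number of gradient evaluations: $$\mathcal{O}\left(\max\left\{\frac{L}{\mu_x},\frac{L}{\sqrt{\mu_x\mu_y}}\right\}\log\frac1\epsilon\right).$$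
   Context: Setting. $\mu_x,\mu_y,L>0$. $F:\mathbb{R}^{d_x}\times\mathbb{R}^{d_y}\to\mathbb{R}$ is continuously differentiable; $F(\cdot,y)$ is $\mu_x$-strongly convex for every $y$; $F(x,\cdot)$ is $\mu_y$-strongly concave for every $x$; and $F$ is $L$-smooth: $\|\nabla F(x_1,y_1)-\nabla F(x_2,y_2)\|^2\le L^2(\|x_1-x_2\|^2+\|y_1-y_2\|^2)$ for all $x_1,x_2,y_1,y_2$. The functions $r:\mathbb{R}^{d_x}\to\mathbb{R}\cup\{+\infty\}$ and $g:\mathbb{R}^{d_y}\to\mathbb{R}\cup\{+\infty\}$ are proper, lower semicontinuous and convex. The problem has a unique solution $(x^*,y^* )$, characterized by $-\nabla_xF(x^*,y^* )\in\partial r(x^* )$ and $\nabla_yF(x^*,y^* )\in\partial g(y^* )$. A pair $(x,y)$ is an $\epsilon$-accurate solution if $\|x-x^*\|^2+\|y-y^*\|^2\le\epsilon$. Notation. $\hat F(x,y)=F(x,y)-\frac{\mu_x}{2}\|x\|^2+\frac{\mu_y}{2}\|y\|^2$. For $c>0$, $\mathrm{prox}_{c h}(v)=\arg\min_{v'}\{h(v')+\frac1{2c}\|v'-v\|^2\}$. Given $(z_g^k,y_g^k)$, $a_x^k(x,y)=\nabla_x\hat F(x,y)+\frac{\mu_x}{2}(x-\mu_x^{-1}z_g^k)$ and $a_y^k(x,y)=-\nabla_y\hat F(x,y)+\mu_y y+\theta_y^{-1}(y-y_g^k)$. Algorithm FOAM. Input: $z^0=z_f^0\in\mathbb{R}^{d_x}$,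 $y^0=y_f^0\in\mathbb{R}^{d_y}$. Parameters: $\alpha\in(0,1]$, $\eta_z,\eta_y,\theta_y>0$, $\{\beta_t\}_{t\ge0}\subset(0,1)$, $\lambda,\gamma_x,\gamma_y>0$, $K\in\{1,2,\ldots\}$. For $k=0,\ldots,K-1$: 1. $(z_g^k,y_g^k)=\alpha(z^k,y^k)+(1-\alpha)(z_f^k,y_f^k)$. 2. $(x^{k,-1},y^{k,-1})=(-\mu_x^{-1}z_g^k,y_g^k)$. 3. $x^{k,0}=\mathrm{prox}_{\gamma_x\lambda r}(x^{k,-1}-\gamma_x\lambda a_x^k(x^{k,-1},y^{k,-1}))$, $y^{k,0}=\mathrm{prox}_{\gamma_y\lambda g}(y^{k,-1}-\gamma_y\lambda a_y^k(x^{k,-1},y^{k,-1}))$. 4. $b_x^{k,0}=\frac1{\gamma_x\lambda}(x^{k,-1}-\gamma_x\lambda a_x^k(x^{k,-1},y^{k,-1})-x^{k,0})$, $b_y^{k,0}=\frac1{\gamma_y\lambda}(y^{k,-1}-\gamma_y\lambda a_y^k(x^{k,-1},y^{k,-1})-y^{k,0})$; set $t=0$. 5. While the condition $\gamma_x\|a_x^k(x^{k,t},y^{k,t})+b_x^{k,t}\|^2+\gamma_y\|a_y^k(x^{k,t},y^{k,t})+b_y^{k,t}\|^2\le\gamma_x^{-1}\|x^{k,t}-x^{k,-1}\|^2+\gamma_y^{-1}\|y^{k,t}-y^{k,-1}\|^2$ is not satisfied, do: $x^{k,t+1/2}=x^{k,t}+\beta_t(x^{k,0}-x^{k,t})-\gamma_x\lambda(a_x^k(x^{k,t},y^{k,t})+b_x^{k,t})$;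 $y^{k,t+1/2}=y^{k,t}+\beta_t(y^{k,0}-y^{k,t})-\gamma_y\lambda(a_y^k(x^{k,t},y^{k,t})+b_y^{k,t})$; $x^{k,t+1}=\mathrm{prox}_{\gamma_x\lambda r}(x^{k,t}+\beta_t(x^{k,0}-x^{k,t})-\gamma_x\lambda a_x^k(x^{k,t+1/2},y^{k,t+1/2}))$; $y^{k,t+1}=\mathrm{prox}_{\gamma_y\lambda g}(y^{k,t}+\beta_t(y^{k,0}-y^{k,t})-\gamma_y\lambda a_y^k(x^{k,t+1/2},y^{k,t+1/2}))$; $b_x^{k,t+1}=\frac1{\gamma_x\lambda}(x^{k,t}+\beta_t(x^{k,0}-x^{k,t})-\gamma_x\lambda a_x^k(x^{k,t+1/2},y^{k,t+1/2})-x^{k,t+1})$; $b_y^{k,t+1}=\frac1{\gamma_y\lambda}(y^{k,t}+\beta_t(y^{k,0}-y^{k,t})-\gamma_y\lambda a_y^k(x^{k,t+1/2},y^{k,t+1/2})-y^{k,t+1})$; $t\leftarrow t+1$. 6. $t^k=t$; $(x_f^{k+1},y_f^{k+1})=(x^{k,t^k},y^{k,t^k})$; $z_f^{k+1}=\nabla_x\hat F(x_f^{k+1},y_f^{k+1})+b_x^{k,t^k}$; $w_f^{k+1}=-\nabla_y\hat F(x_f^{k+1},y_f^{k+1})+b_y^{k,t^k}$. 7. $z^{k+1}=z^k+\eta_z\mu_x^{-1}(z_f^{k+1}-z^k)-\eta_z(x_f^{k+1}+\mu_x^{-1}z_f^{k+1})$; $y^{k+1}=y^k+\eta_y\mu_y(y_f^{k+1}-y^k)-\eta_y(w_f^{k+1}+\mu_yy_f^{k+1})$.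 Output: $(-\mu_x^{-1}z^K,y^K)$. Complexity convention. A gradient evaluation is one evaluation of $\nabla F$ (that is, of $\nabla_xF$ and/or $\nabla_yF$) at a point. ''Requires $\mathcal{O}(Q\log\frac1\epsilon)$ gradient evaluations'' means: there are a universal constant $c>0$ and a constant $C\geq 2$, possibly depending on the problem, the parameters and the initial point but not on $\epsilon$, such that for every $\epsilon\in(0,1)$ the number $K$ of outer iterations can be chosen so that the output is an $\epsilon$-accurate solution and the total number of gradient evaluations performed is at most $cQ\log\frac{C}{\epsilon}$. *)

(* Defs.v *)
From mathcomp Require Import all_boot all_order all_algebra.
From mathcomp Require Import all_classical all_reals all_analysis.

Set Implicit Arguments.
Unset Strict Implicit.
Unset Printing Implicit Defensive.

Import Order.TTheory GRing.Theory Num.Theory.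
Import numFieldNormedType.Exports.

Local Open Scope classical_set_scope.
Local Open Scope ring_scope.

(* The library norm on 'rV[R]_n is the sup norm; this is the squared Euclidean
   norm. Both induce the same topology, so the library notions of
   differentiability, continuity and semicontinuity can be used as they are. *)
Definition sqnorm (R : realType) (n : nat) (v : 'rV[R]_n) : R :=
  \sum_(i < n) v 0 i ^+ 2.

Definition grad (R : realType) (n : nat) (f : 'rV[R]_n -> R) (v : 'rV[R]_n) :
    'rV[R]_n :=
  \row_(i < n) 'D_(delta_mx 0 i) f v.

Definition grad_x (R : realType) (dx dy : nat)
    (F : 'rV[R]_dx -> 'rV[R]_dy -> R) (x : 'rV[R]_dx) (y : 'rV[R]_dy) :=
  grad (fun u => F u y) x.

Definition grad_y (R : realType) (dx dy : nat)
    (F : 'rV[R]_dx -> 'rV[R]_dy -> R) (x : 'rV[R]_dx) (y : 'rV[R]_dy) :=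
  grad (F x) y.

Definition continuously_differentiable (R : realType) (dx dy : nat)
    (F : 'rV[R]_dx -> 'rV[R]_dy -> R) : Prop :=
  [/\ forall p : 'rV[R]_dx * 'rV[R]_dy,
        differentiable (fun q : 'rV[R]_dx * 'rV[R]_dy => F q.1 q.2) p,
      continuous (fun p : 'rV[R]_dx * 'rV[R]_dy => grad_x F p.1 p.2) &
      continuous (fun p : 'rV[R]_dx * 'rV[R]_dy => grad_y F p.1 p.2)].

Definition strongly_convex (R : realType) (n : nat) (mu : R)
    (f : 'rV[R]_n -> R) : Prop :=
  forall (u v : 'rV[R]_n) (t : R), 0 <= t <= 1 ->
    f (t *: u + (1 - t) *: v) <=
    t * f u + (1 - t) * f v - mu / 2 * t * (1 - t) * sqnorm (u - v).

Definition strongly_concave (R : realType) (n : nat) (mu : R)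
    (f : 'rV[R]_n -> R) : Prop :=
  strongly_convex mu (fun v => - f v).

Definition smooth (R : realType) (dx dy : nat) (L : R)
    (F : 'rV[R]_dx -> 'rV[R]_dy -> R) : Prop :=
  forall (x1 x2 : 'rV[R]_dx) (y1 y2 : 'rV[R]_dy),
    sqnorm (grad_x F x1 y1 - grad_x F x2 y2) +
      sqnorm (grad_y F x1 y1 - grad_y F x2 y2) <=
    L ^+ 2 * (sqnorm (x1 - x2) + sqnorm (y1 - y2)).

Definition proper (R : realType) (n : nat) (h : 'rV[R]_n -> \bar R) : Prop :=
  (forall v, h v != -oo%E) /\ (exists v, h v != +oo%E).

(* At t = 0 or t = 1 the convention 0 * +oo = 0 makes the inequality trivial. *)
Definition convex_ext (R : realType) (n : nat) (h : 'rV[R]_n -> \bar R) :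
    Prop :=
  forall (u v : 'rV[R]_n) (t : R), 0 <= t <= 1 ->
    (h (t *: u + (1 - t) *: v)%R <= t%:E * h u + (1 - t)%:E * h v)%E.

Definition proper_lsc_convex (R : realType) (n : nat)
    (h : 'rV[R]_n -> \bar R) : Prop :=
  [/\ proper h, lower_semicontinuous h & convex_ext h].

(* Where r x = g y = +oo the value is -oo; since g is proper, this affects
   neither the supremum over y nor the set of solutions. *)
Definition objective (R : realType) (dx dy : nat)
    (F : 'rV[R]_dx -> 'rV[R]_dy -> R) (r : 'rV[R]_dx -> \bar R)
    (g : 'rV[R]_dy -> \bar R) (x : 'rV[R]_dx) (y : 'rV[R]_dy) : \bar R :=
  (r x + (F x y)%:E - g y)%E.

Definition minimax_solution (R : realType) (dx dy : nat)
    (F : 'rV[R]_dx -> 'rV[R]_dy -> R) (r : 'rV[R]_dx -> \bar R)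
    (g : 'rV[R]_dy -> \bar R) (x : 'rV[R]_dx) (y : 'rV[R]_dy) : Prop :=
  (forall x', ereal_sup (range (objective F r g x)) <=
              ereal_sup (range (objective F r g x')))%E /\
  (forall y', objective F r g x y' <= objective F r g x y)%E.

Definition accurate (R : realType) (dx dy : nat) (xs : 'rV[R]_dx)
    (ys : 'rV[R]_dy) (eps : R) (x : 'rV[R]_dx) (y : 'rV[R]_dy) : Prop :=
  sqnorm (x - xs) + sqnorm (y - ys) <= eps.

(* The minimizer is unique when 0 < c and h is proper, lsc and convex; [get]
   returns an arbitrary vector if there is none. *)
Definition prox (R : realType) (n : nat) (c : R) (h : 'rV[R]_n -> \bar R)
    (v : 'rV[R]_n) : 'rV[R]_n :=
  get [set u | forall w, (h u + ((2 * c)^-1 * sqnorm (u - v))%:E <=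
                          h w + ((2 * c)^-1 * sqnorm (w - v))%:E)%E].

Record foam_params (R : realType) := FoamParams {
  alpha : R; eta_z : R; eta_y : R; theta_y : R;
  beta_ : nat -> R;
  lambda : R; gamma_x : R; gamma_y : R }.

Record inner_state (R : realType) (dx dy : nat) := InnerState {
  in_x : 'rV[R]_dx; in_y : 'rV[R]_dy; in_bx : 'rV[R]_dx; in_by : 'rV[R]_dy }.

Record outer_state (R : realType) (dx dy : nat) := OuterState {
  out_z : 'rV[R]_dx; out_y : 'rV[R]_dy;
  out_zf : 'rV[R]_dx; out_yf : 'rV[R]_dy }.

Section Foam.
Variables (R : realType) (dx dy : nat) (F : 'rV[R]_dx -> 'rV[R]_dy -> R).
Variables (r : 'rV[R]_dx -> \bar R) (g : 'rV[R]_dy -> \bar R).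
Variables (mux muy : R) (p : foam_params R).

Definition Fhat (x : 'rV[R]_dx) (y : 'rV[R]_dy) : R :=
  F x y - mux / 2 * sqnorm x + muy / 2 * sqnorm y.

Section Inner.
Variables (zg : 'rV[R]_dx) (yg : 'rV[R]_dy).

Definition a_x (x : 'rV[R]_dx) (y : 'rV[R]_dy) : 'rV[R]_dx :=
  grad_x Fhat x y + (mux / 2) *: (x - mux^-1 *: zg).

Definition a_y (x : 'rV[R]_dx) (y : 'rV[R]_dy) : 'rV[R]_dy :=
  - grad_y Fhat x y + muy *: y + (theta_y p)^-1 *: (y - yg).

(* The pair (x^{k,-1}, y^{k,-1}). *)
Definition x_start : 'rV[R]_dx := - (mux^-1 *: zg).
Definition y_start : 'rV[R]_dy := yg.

(* Forward-backward step from (u, v) with the forward operator (a_x, a_y)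
   evaluated at (x, y), together with the resulting b_x and b_y. *)
Definition prox_step (u : 'rV[R]_dx) (v : 'rV[R]_dy) (x : 'rV[R]_dx)
    (y : 'rV[R]_dy) : inner_state R dx dy :=
  let cx := gamma_x p * lambda p in
  let cy := gamma_y p * lambda p in
  let x' := prox cx r (u - cx *: a_x x y) in
  let y' := prox cy g (v - cy *: a_y x y) in
  InnerState x' y'
    (cx^-1 *: (u - cx *: a_x x y - x'))
    (cy^-1 *: (v - cy *: a_y x y - y')).

Definition inner_init : inner_state R dx dy :=
  prox_step x_start y_start x_start y_start.

Definition inner_next (t : nat) (s : inner_state R dx dy) :
    inner_state R dx dy :=
  let u := in_x s + beta_ p t *: (in_x inner_init - in_x s) in
  let v := in_y s + beta_ p t *: (in_y inner_init - in_y s) in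
  let x_half :=
    u - (gamma_x p * lambda p) *: (a_x (in_x s) (in_y s) + in_bx s) in
  let y_half :=
    v - (gamma_y p * lambda p) *: (a_y (in_x s) (in_y s) + in_by s) in
  prox_step u v x_half y_half.

(* Unrolled regardless of the stopping test, which is applied in
   [inner_stops_at]. *)
Fixpoint inner (t : nat) : inner_state R dx dy :=
  if t is t'.+1 then inner_next t' (inner t') else inner_init.

Definition stop_test (s : inner_state R dx dy) : bool :=
  gamma_x p * sqnorm (a_x (in_x s) (in_y s) + in_bx s) +
    gamma_y p * sqnorm (a_y (in_x s) (in_y s) + in_by s) <=
  (gamma_x p)^-1 * sqnorm (in_x s - x_start) +
    (gamma_y p)^-1 * sqnorm (in_y s - y_start).

Definition inner_stops_at (t : nat) : Prop :=
  stop_test (inner t) /\ forall s : nat, (s < t)%N -> ~~ stop_test (inner s).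

End Inner.

Definition z_g (s : outer_state R dx dy) : 'rV[R]_dx :=
  alpha p *: out_z s + (1 - alpha p) *: out_zf s.

Definition y_g (s : outer_state R dx dy) : 'rV[R]_dy :=
  alpha p *: out_y s + (1 - alpha p) *: out_yf s.

Definition outer_next (s : outer_state R dx dy) (t : nat) :
    outer_state R dx dy :=
  let i := inner (z_g s) (y_g s) t in
  let xf := in_x i in
  let yf := in_y i in
  let zf := grad_x Fhat xf yf + in_bx i in
  let wf := - grad_y Fhat xf yf + in_by i in
  OuterState
    (out_z s + (eta_z p * mux^-1) *: (zf - out_z s)
       - eta_z p *: (xf + mux^-1 *: zf))
    (out_y s + (eta_y p * muy) *: (yf - out_y s)
       - eta_y p *: (wf + muy *: yf))
    zf yf.

(* An outer iteration whose inner loop stops at t evaluates the gradient at the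
   starting point, at the iterates of index 0, ..., t (stopping test; the value
   is reused in the loop body and in the computation of zf and wf), and at the
   half-step points of index 1/2, ..., t - 1/2. *)
Definition outer_cost (t : nat) : nat := (1 + t.+1 + t)%N.

(* [foam_run z0 y0 K s N]: from (z0, y0), the first K outer iterations all
   terminate, lead to the state s, and perform N gradient evaluations. *)
Inductive foam_run (z0 : 'rV[R]_dx) (y0 : 'rV[R]_dy) :
    nat -> outer_state R dx dy -> nat -> Prop :=
| foam_run_init : foam_run z0 y0 0 (OuterState z0 y0 z0 y0) 0
| foam_run_step K s N t :
    foam_run z0 y0 K s N -> inner_stops_at (z_g s) (y_g s) t ->
    foam_run z0 y0 K.+1 (outer_next s t) (N + outer_cost t).

End Foam.

(* Main.v *)
Require Import Defs.
From mathcomp Require Import all_boot all_order all_algebra finmap.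
From mathcomp Require Import all_classical all_reals all_analysis.
From mathcomp Require Import ring lra.

Set Implicit Arguments.
Unset Strict Implicit.
Unset Printing Implicit Defensive.

Import Order.TTheory GRing.Theory Num.Theory.
Import numFieldNormedType.Exports.

Local Open Scope classical_set_scope.
Local Open Scope ring_scope.

(** Write H for the hat function [Fhat], which is convex in x and concave in y,
    and put G(z, y) = sup_x (<x, z> - r x - H(x, y)) + g y, a jointly convex
    function.  The saddle point problem is equivalent to the minimization of
    P(z, y) = G(z, y) + |z|^2 / (2 mux) + muy |y|^2 / 2, with z = - mux x at
    the solution.
    If z - grad_x H(x, y) is a subgradient of r at x and w + grad_y H(x, y) one
    of g at y, then the supremum is attained at x and (x, w) is a subgradient
    of G at (z, y).  Only such points, called certified, are used: at a
    certified point G is given by a closed formula ([dual_value]), and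
    [dual_value_ge] is the strong convexity of P.

    The outer loop is Nesterov acceleration applied to P, with an inexact
    proximal step.  The stopping test bounds the error of that step relatively
    to its length, and [stop_test_descent] extracts from it the inequality that
    an exact step would give.  With [momentum_step] it follows that every outer
    iteration multiplies the function [lyapunov] by at most 1 - alpha / 2
    ([lyapunov_contraction]).  The initial point need not be certified, and
    g y0 may even be +oo, so the contraction is counted from the state reached
    after one iteration, and the constant C depends on that state.

    The inner loop is an extragradient method with Halpern anchoring, applied
    to the sum of a monotone Lipschitz operator A and a subdifferential.  The
    residual is controlled by a potential ([potential_step]).  Instead of
    comparing the iterates with a zero of the operator,
    [anchored_extragradient] argues by contradiction: as long as the stopping
    test fails, the distances between the current iterate, the starting point
    and the anchor are all bounded by a multiple of the current residual, and
    the potential then bounds the iteration number by a multiple of 1 / lambda,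
    that is, of L / mux.

    The solution (xs, ys) gives a certified point by the first-order conditions
    ([solution_certified]), which are derived from the definition of a minimax
    solution by bounding the inner supremum quadratically along segments issued
    from xs.  Finally, (L / mux) / alpha is at most the maximum in the statement
    ([ratio_le_max]). *)

(** * The Euclidean inner product *)

Definition dot (R : realType) (n : nat) (u v : 'rV[R]_n) : R :=
  \sum_(i < n) u 0 i * v 0 i.

Section Dot.
Context {R : realType} {n : nat}.
Implicit Types (u v w : 'rV[R]_n) (c : R).

Lemma sqnormE u : sqnorm u = dot u u.
Proof. by apply: eq_bigr => i _; rewrite expr2. Qed.

Lemma dotC u v : dot u v = dot v u.
Proof. by apply: eq_bigr => i _; rewrite mulrC. Qed.

Lemma dotDl u v w : dot (u + v) w = dot u w + dot v w.
Proof. by rewrite -big_split; apply: eq_bigr => i _; rewrite mxE mulrDl. Qed.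

Lemma dotZl c u v : dot (c *: u) v = c * dot u v.
Proof. by rewrite mulr_sumr; apply: eq_bigr => i _; rewrite mxE mulrA. Qed.

Lemma dotNl u v : dot (- u) v = - dot u v.
Proof. by rewrite -scaleN1r dotZl mulN1r. Qed.

Lemma dotDr u v w : dot u (v + w) = dot u v + dot u w.
Proof. by rewrite !(dotC u) dotDl. Qed.

Lemma dotZr c u v : dot u (c *: v) = c * dot u v.
Proof. by rewrite !(dotC u) dotZl. Qed.

Lemma dotNr u v : dot u (- v) = - dot u v.
Proof. by rewrite !(dotC u) dotNl. Qed.

Lemma dot0r u : dot u 0 = 0.
Proof. by rewrite -(scale0r u) dotZr mul0r. Qed.

Definition dotE := (dotDl, dotDr, dotNl, dotNr, dotZl, dotZr).

Lemma sqnorm_ge0 u : 0 <= sqnorm u.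
Proof. by apply: sumr_ge0 => i _; exact: sqr_ge0. Qed.

Lemma sqnorm0 : sqnorm (0 : 'rV[R]_n) = 0.
Proof. by apply: big1 => i _; rewrite mxE expr0n. Qed.

Lemma sqnormN u : sqnorm (- u) = sqnorm u.
Proof. by rewrite !sqnormE dotNl dotNr opprK. Qed.

Lemma sqnormZ c u : sqnorm (c *: u) = c ^+ 2 * sqnorm u.
Proof. by rewrite !sqnormE dotZl dotZr mulrA expr2. Qed.

Lemma sqnorm_eq0 u : sqnorm u = 0 -> u = 0.
Proof.
move=> /eqP; rewrite psumr_eq0; last by move=> j _; exact: sqr_ge0.
move=> /allP u0; apply/rowP => i; rewrite mxE; apply/eqP.
by rewrite -sqrf_eq0; apply: u0; rewrite mem_index_enum.
Qed.

Lemma sqnormD_le u v : sqnorm (u + v) <= 2 * sqnorm u + 2 * sqnorm v.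
Proof.
have := sqnorm_ge0 (u - v).
by rewrite !sqnormE !dotE (dotC v u) => ?; lra.
Qed.

Lemma sqnormB_le u v : sqnorm (u - v) <= 2 * sqnorm u + 2 * sqnorm v.
Proof. by rewrite -(sqnormN v) sqnormD_le. Qed.

Lemma dot_young c u v : 0 < c -> 2 * dot u v <= c * sqnorm u + c^-1 * sqnorm v.
Proof.
move=> c0; have := sqnorm_ge0 (c *: u - v).
rewrite !sqnormE !dotE (dotC v u) => h.
rewrite -(ler_pM2l c0) [leRHS]mulrDr [X in _ <= _ + X]mulrA mulfV ?gt_eqF// mul1r.
by nra.
Qed.

Lemma cauchy_schwarz u v : dot u v ^+ 2 <= sqnorm u * sqnorm v.
Proof.
have := sqnorm_ge0 (sqnorm v *: u - dot u v *: v).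
rewrite !sqnormE !dotE (dotC v u) => h.
have := sqnorm_ge0 v; rewrite sqnormE le_eqVlt => /orP[/eqP v0|v0]; last by nra.
have v00 : v = 0 by apply: sqnorm_eq0; rewrite sqnormE.
by rewrite v00 !dot0r expr0n mulr0.
Qed.

Lemma dot_delta u i : dot u (delta_mx 0 i) = u 0 i.
Proof.
rewrite /dot (bigD1 i)//= mxE !eqxx mulr1 big1 ?addr0// => j ji.
by rewrite mxE eqxx/= (negbTE ji) mulr0.
Qed.

Lemma sqnorm_delta i : sqnorm (delta_mx 0 i : 'rV[R]_n) = 1.
Proof. by rewrite sqnormE dot_delta mxE !eqxx. Qed.

End Dot.

Lemma dot_row_mx (R : realType) (m n : nat) (a c : 'rV[R]_m) (b d : 'rV[R]_n) :
  dot (row_mx a b) (row_mx c d) = dot a c + dot b d.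
Proof.
rewrite /dot big_split_ord/=; congr (_ + _); apply: eq_bigr => i _.
  by rewrite !row_mxEl.
by rewrite !row_mxEr.
Qed.

Lemma sqnorm_row_mx (R : realType) (m n : nat) (a : 'rV[R]_m) (b : 'rV[R]_n) :
  sqnorm (row_mx a b) = sqnorm a + sqnorm b.
Proof. by rewrite !sqnormE dot_row_mx. Qed.

(** * Gradients *)

Section Gradients.
Context {R : realType}.

Lemma derive_grad (n : nat) (f : 'rV[R]_n -> R) (x v : 'rV[R]_n) :
  differentiable f x -> 'D_v f x = dot (grad f x) v.
Proof.
move=> df; rewrite deriveE// {1}(row_sum_delta v) linear_sum/=.
by apply: eq_bigr => i _; rewrite linearZ/= /grad mxE deriveE// mulrC.
Qed.

(** Divide the strong convexity inequality between x and x + h (w - x) by h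
    and let h tend to 0 from the right. *)
Lemma strongly_convex_grad (n : nat) (mu : R) (f : 'rV[R]_n -> R)
    (x w : 'rV[R]_n) :
  differentiable f x -> strongly_convex mu f ->
  f x + dot (grad f x) (w - x) + mu / 2 * sqnorm (w - x) <= f w.
Proof.
move=> df cf; rewrite -derive_grad//.
have dfx := @diff_derivable _ _ _ _ _ (w - x) df.
pose q (h : R) := h^-1 *: ((f \o shift x) (h *: (w - x)) - f x).
have cq : q h + (- (mu / 2 * sqnorm (w - x))) * h @[h --> 0^'+] -->
    'D_(w - x) f x + (- (mu / 2 * sqnorm (w - x))) * 0.
  apply: cvgD; first exact: (cvg_dnbhs_at_right dfx).
  by apply: cvgMl_tmp; exact: cvg_at_right_filter.
rewrite mulr0 addr0 in cq; rewrite -addrA -lerBrDl -lerBrDr.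
apply: (cvgr_to_le cq); near=> h.
have h0 : 0 < h by near: h; exact: nbhs_right_gt.
have h1 : h <= 1 by near: h; exact: nbhs_right_le.
have := cf w x h; rewrite h1 ltW// => /(_ isT).
rewrite /q /= [h^-1 *: _]mulrC -lerBrDr ler_pdivrMr//.
have -> : h *: w + (1 - h) *: x = h *: (w - x) + x.
  by rewrite scalerBl scalerBr scale1r addrA addrAC.
lra.
Unshelve. all: end_near. Qed.

(** The difference quotient of the quadratic term is an explicit affine function
    of the step. *)
Lemma grad_add_sqnorm (n : nat) (f : 'rV[R]_n -> R) (c d : R) (x : 'rV[R]_n) :
  differentiable f x ->
  grad (fun u => f u + c / 2 * sqnorm u + d) x = grad f x + c *: x.
Proof.
move=> df; apply/rowP => i; rewrite !mxE /derive; apply: cvg_lim => //.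
have /= df' := @diff_derivable _ _ _ _ _ (delta_mx 0 i) df.
pose q (h : R) : R := c * x 0 i + c / 2 * h.
have cq : q @ 0^' --> c * x 0 i.
  rewrite -[X in _ --> X]addr0 -[X in _ --> _ + X](mulr0 (c / 2)).
  apply: cvgD; first exact: cvg_cst.
  by apply: cvgMl_tmp; apply: nbhs_dnbhs.
apply: cvg_trans (cvgD df' cq); apply: near_eq_cvg.
near=> h; have h0 : h != 0 by near: h; exact: nbhs_dnbhs_neq.
rewrite [LHS](_ : _ = h^-1 * (f (h *: delta_mx 0 i + x) - f x) + q h)//=.
rewrite /q !sqnormE !dotE (dotC _ x) !dot_delta !mxE !eqxx -[RHS]/(_ * _) /=.
by field.
Unshelve. all: end_near. Qed.

End Gradients.

(** * Proximal points and subgradients *)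

Lemma lsc_open_gt (R : realType) (T : topologicalType) (f : T -> \bar R)
    (e : \bar R) :
  lower_semicontinuous f -> open [set x | (e < f x)%E].
Proof.
move=> lf; case: e => [a||].
- exact: (lower_semicontinuousP f).1.
- rewrite [X in open X](_ : _ = set0); first exact: open0.
  by apply/seteqP; split => x //=; rewrite ltNge leey.
- rewrite openE => x /=; rewrite /interior/= => fx.
  have [a /lf[V nV Vf]] : exists a : R, (a%:E < f x)%E.
    case: (f x) fx => [b||//] _; last by exists 0; rewrite ltry.
    by exists (b - 1); rewrite lte_fin ltrBlDr ltrDl.
  by apply: filterS nV => y /Vf; apply: lt_trans; rewrite ltNye.
Qed.

(** Without a minimizer, the open sets of the points x with f c < f x, for c in
    K, would cover K; a point c of least value among the centres of a finite
    subcover would lie in none of them. *)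
Lemma lsc_compact_min (R : realType) (T : ptopologicalType) (f : T -> \bar R)
    (K : set T) :
  compact K -> K !=set0 -> lower_semicontinuous f ->
  exists2 c, K c & forall x, K x -> (f c <= f x)%E.
Proof.
move=> cK [x0 Kx0] lf; apply: contrapT => /forall2NP noMin.
have lower x : K x -> exists2 c, K c & (f c < f x)%E.
  move=> Kx; case: (noMin x) => // /existsNP[c /not_implyP[Kc /negP]].
  by rewrite -ltNge => fcx; exists c.
move: cK; rewrite compact_cover => /(_ T K (fun c => [set x | (f c < f x)%E])).
case=> [c _|x /lower[c Kc fcx]|D DK cov].
- exact: lsc_open_gt.
- by exists c.
- have [d0 /= d0D _] := cov _ Kx0.
  pose m := [arg min_(i < [` d0D]%fset) f (val i)]%O.
  have mmin (d : D) : (f (val m) <= f (val d))%E.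
    by rewrite /m; case: arg_minP => //= i _; apply.
  have [d /= dD] := cov (val m) (set_mem (DK _ (valP m))).
  by rewrite ltNge (mmin [` dD]%fset).
Qed.

Section Euclidean.
Context {R : realType} {n : nat}.
Implicit Types (u v w b : 'rV[R]_n) (h : 'rV[R]_n -> \bar R).

Lemma continuous_sqnorm : continuous (@sqnorm R n).
Proof.
move=> x; rewrite /sqnorm; apply: (@cvg_big R _ +%R 0 xpredT _ _ (nbhs x)).
  exact: add_continuous.
by move=> i _; apply: cvgM; exact: coord_continuous.
Qed.

Lemma continuous_add_sqnormB (a c : R) v :
  continuous (fun u => a + c * sqnorm (u - v)).
Proof.
move=> x; apply: (@cvgD R R _ (nbhs x) _ (cst a)); first exact: cvg_cst.
apply: cvgMl_tmp.
apply: (@cvg_comp _ _ _ (fun u => u - v) (@sqnorm R n) _ (nbhs (x - v))).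
  apply: (@cvgB R 'rV[R]_n _ (nbhs x) _ id (cst v)); first exact: cvg_id.
  exact: cvg_cst.
exact: continuous_sqnorm.
Qed.

(** Coercivity is proved for the sup norm, whose closed balls are compact. *)
Lemma norm_le_sqnorm u : `|u| ^+ 2 <= sqnorm u.
Proof.
have [->|u0] := eqVneq `|u| 0; first by rewrite expr0n sqnorm_ge0.
have [[i j] /= uij] := mx_norm_neq0 u0; rewrite [ `|u| ]uij.
rewrite real_normK ?num_real// ord1 /sqnorm (bigD1 j)//= lerDl.
by apply: sumr_ge0 => k _; exact: sqr_ge0.
Qed.

Lemma le0_of_small (x c : R) : (forall t, 0 < t <= 1 -> x <= c * t) -> x <= 0.
Proof.
move=> small; rewrite leNgt; apply/negP => x0.
have xc : x <= c by have := small 1; rewrite ltr01 lexx mulr1; exact.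
have c0 : 0 < c by exact: lt_le_trans xc.
have := small (x / (2 * c)).
have -> : c * (x / (2 * c)) = x / 2 by field; rewrite gt_eqF.
rewrite divr_gt0 ?mulr_gt0//= ler_pdivrMr ?mulr_gt0// mul1r => /(_ _)/wrap[]; lra.
Qed.

Definition subgrad h u b : Prop :=
  h u \is a fin_num /\ forall w, (h u + (dot b (w - u))%:E <= h w)%E.

(** A function whose values along each segment issued from u are, to first
    order, at least those of the linear form b has b as a subgradient: by
    convexity the second-order error can be sent to 0.  The optimality
    conditions for proximal points and for both components of a minimax solution
    are instances of this. *)
Lemma subgrad_of_descent h u b :
  convex_ext h -> h u \is a fin_num ->
  (forall w, h w \is a fin_num -> exists c, forall t, 0 < t <= 1 ->
     (h u <= h (u + t *: (w - u))%R +
       (- t * dot b (w - u) + c * t ^+ 2)%:E)%E) ->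
  (forall w, h w != -oo%E) -> subgrad h u b.
Proof.
move=> ch hu descent hNy; split=> // w.
have [hw|] := boolP (h w \is a fin_num); last first.
  by rewrite fin_numE hNy/= negbK => /eqP ->; rewrite leey.
have [c desc] := descent w hw.
have hwE := fineK hw; have huE := fineK hu.
rewrite -hwE -huE -EFinD lee_fin -subr_le0.
apply: (@le0_of_small _ c) => t t01.
have t0 : 0 < t by case/andP: t01.
have := ch w u t.
have -> : t *: w + (1 - t) *: u = u + t *: (w - u).
  by rewrite scalerBl scalerBr scale1r addrCA.
rewrite (ltW t0) (andP t01).2 => /(_ isT).
move=> /(leeD2r (- t * dot b (w - u) + c * t ^+ 2)%:E) /(le_trans (desc t t01)).
rewrite -hwE -huE -!EFinM -!EFinD lee_fin => ineq.
by rewrite -(ler_pM2l t0); lra.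
Qed.

Lemma subgrad_monotone h u v b c :
  subgrad h u b -> subgrad h v c -> 0 <= dot (b - c) (u - v).
Proof.
move=> [hu /(_ v) +] [hv /(_ u)]; rewrite -(fineK hu) -(fineK hv).
by rewrite -!EFinD !lee_fin !dotE; lra.
Qed.

(** Lower semicontinuity bounds h from below on the unit ball around a point of
    its domain; convexity propagates this to an affine lower bound in the
    distance outside the ball, which the quadratic term dominates.  Hence the
    minimization can be restricted to a compact ball. *)
Lemma prox_exists (c : R) h v :
  0 < c -> proper_lsc_convex h ->
  exists u, h u \is a fin_num /\
    forall w, (h u + (c * sqnorm (u - v))%:E <= h w + (c * sqnorm (w - v))%:E)%E.
Proof.
move=> c0 [[hNy [v0 hv0]] lh ch].
have hv0f : h v0 \is a fin_num by rewrite fin_numE hNy.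
have compact_ball rho : compact (closed_ball_ (fun x => `|x|) v0 rho).
  apply: bounded_closed_compact; last exact: closed_closed_ball_.
  exists (`|v0| + rho); split; first exact: num_real.
  move=> M ltM u /= ur; apply: le_trans (ltW ltM).
  by rewrite -[u](subKr v0) (le_trans (ler_normB _ _))// lerD2l.
have ball0 rho : 0 <= rho -> closed_ball_ (fun x => `|x|) v0 rho v0.
  by move=> r0; rewrite /closed_ball_/= subrr normr0.
have [m _ mmin] := lsc_compact_min (compact_ball 1) (ex_intro _ _ (ball0 _ ler01)) lh.
have hmf : h m \is a fin_num.
  rewrite fin_numE hNy/= -ltey (le_lt_trans (mmin _ (ball0 _ ler01)))//.
  by rewrite ltey.
pose k := fine (h v0) - fine (h m).
have k0 : 0 <= k.
  by rewrite subr_ge0 -lee_fin !fineK//; apply: mmin; exact: ball0.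
(* w is compared with the point of the segment from v0 to w at distance 1
   from v0. *)
have linear_bound w : 1 <= `|v0 - w| ->
    ((fine (h v0) - `|v0 - w| * k)%:E <= h w)%E.
  move=> N1; have [hw|] := boolP (h w \is a fin_num); last first.
    by rewrite fin_numE hNy/= negbK => /eqP ->; rewrite leey.
  set N := `|v0 - w|; have N0 : 0 < N by exact: lt_le_trans N1.
  have := ch w v0 N^-1; rewrite invr_ge0 (ltW N0) invf_le1// N1 => /(_ isT).
  have : (h m <= h (N^-1 *: w + (1 - N^-1) *: v0)%R)%E.
    apply: mmin; rewrite /closed_ball_/=.
    have -> : v0 - (N^-1 *: w + (1 - N^-1) *: v0) = N^-1 *: (v0 - w).
      by apply/rowP => i; rewrite !mxE; ring.
    by rewrite normrZ ger0_norm ?invr_ge0 ?(ltW N0)// mulVf ?gt_eqF.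
  move=> /le_trans/[apply]; rewrite -(fineK hw) -(fineK hv0f) -(fineK hmf).
  rewrite -!EFinM -!EFinD !lee_fin /= => ineq.
  have : N * fine (h m) <= N * (N^-1 * fine (h w) + (1 - N^-1) * fine (h v0)).
    by rewrite ler_pM2l.
  by rewrite mulrDr !mulrA mulrBr mulfV ?gt_eqF// /k; lra.
pose phi w := (h w + (c * sqnorm (w - v))%:E)%E.
have lphi : lower_semicontinuous phi.
  move=> w a; rewrite /phi => awlt.
  have [a' a'h aa'] : exists2 a' : R, (a'%:E < h w)%E & a < a' + c * sqnorm (w - v).
    case: (h w) awlt (hNy w) => [b||]// + _.
      rewrite -EFinD lte_fin => ab; exists ((a + b - c * sqnorm (w - v)) / 2).
        by rewrite lte_fin; lra.
      by lra.
    move=> _; exists (a + 1 - c * sqnorm (w - v)); first by rewrite ltry.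
    by lra.
  have [V nV Vh] := lh w a' a'h.
  have cq := @continuous_add_sqnormB a' c v w.
  exists (V `&` [set y | a < a' + c * sqnorm (y - v)]).
    by apply: filterI => //; exact: (cvgr_gt _ cq).
  move=> y [/Vh a'y /= ay]; apply: lt_le_trans (leeD2r _ (ltW a'y)).
  by rewrite -EFinD lte_fin.
pose s := sqnorm (v0 - v); have s0 : 0 <= s by exact: sqnorm_ge0.
(* At a distance N > rho from v0 the quadratic term, at least c (N^2 / 2 - s),
   exceeds the loss N k of the linear bound by at least its value c s at v0. *)
pose rho := 1 + 2 * (k + 2 * c * s) / c.
have rho1 : 1 <= rho by rewrite lerDl divr_ge0 ?(ltW c0)//; nra.
have rho0 : 0 <= rho by exact: le_trans rho1.
have [u _ umin] :=
  lsc_compact_min (compact_ball rho) (ex_intro _ _ (ball0 _ rho0)) lphi.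
have uv0 : (phi u <= phi v0)%E by apply: umin; exact: ball0.
have huf : h u \is a fin_num.
  have := le_lt_trans uv0 (_ : phi v0 < +oo)%E; rewrite fin_numE hNy/= -ltey.
  rewrite {1}/phi -(fineK hv0f) -EFinD ltry => /(_ isT).
  by rewrite /phi !ltey; apply: contra_neq => ->.
exists u; split=> // w; rewrite -/(phi u) -/(phi w).
have [wr|rw] := leP `|v0 - w| rho; first exact: umin.
apply: (le_trans uv0).
have hw := linear_bound w (le_trans rho1 (ltW rw)).
rewrite /phi; apply: le_trans (leeD2r _ hw).
rewrite -(fineK hv0f) -!EFinD lee_fin.
have N2 := norm_le_sqnorm (v0 - w); set N := `|v0 - w| in rw N2 *.
have : sqnorm (v0 - w) <= 2 * sqnorm (w - v) + 2 * s.
  have -> : v0 - w = - (w - v) + (v0 - v) by apply/rowP => i; rewrite !mxE; ring.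
  by apply: le_trans (sqnormD_le _ _) _; rewrite sqnormN.
have : 2 * (k + 2 * c * s) <= c * N.
  rewrite [leRHS]mulrC -ler_pdivrMr//.
  by apply: le_trans (ltW rw); rewrite lerDr.
rewrite -/s; set q := sqnorm (w - v) in N2 *; set d := sqnorm (v0 - w) in N2 *.
move=> h1 h2.
have N1 : 1 <= N by exact: le_trans rho1 (ltW rw).
have : c * N ^+ 2 <= 2 * c * q + 2 * c * s by nra.
have : 2 * (k + 2 * c * s) * N <= c * N ^+ 2 by rewrite expr2 mulrA ler_wpM2r//; lra.
have : 2 * c * s <= 2 * c * s * N by rewrite ler_peMr//; nra.
lra.
Qed.

Lemma prox_subgrad (c : R) h v :
  0 < c -> proper_lsc_convex h ->
  subgrad h (prox c h v) (c^-1 *: (v - prox c h v)).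
Proof.
move=> c0 hP; have c20 : 0 < (2 * c)^-1 by rewrite invr_gt0 mulr_gt0.
have [u0 [u0f u0min]] := prox_exists v c20 hP.
have : [set u | forall w, (h u + ((2 * c)^-1 * sqnorm (u - v))%:E <=
                          h w + ((2 * c)^-1 * sqnorm (w - v))%:E)%E] (prox c h v).
  by apply: xgetPex; exists u0.
set u := prox c h v => /= umin; case: hP => -[hNy _] lh ch.
have hu : h u \is a fin_num.
  have := umin u0; rewrite -(fineK u0f) -EFinD => /le_lt_trans/(_ (ltry _)).
  by rewrite fin_numE hNy/=; case: (h u).
apply: subgrad_of_descent => // w _; exists ((2 * c)^-1 * sqnorm (w - u)) => t _.
have := umin (u + t *: (w - u)); rewrite -(fineK hu).
case: (h (u + t *: (w - u))) (hNy (u + t *: (w - u))) => [a||]// _; last first.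
  by move=> _; rewrite addye// leey.
rewrite -!EFinD !lee_fin; set d := w - u; set e := u - v.
have -> : u + t *: d - v = e + t *: d by rewrite addrAC.
have -> : v - u = - e by rewrite opprB.
clearbody d e; rewrite !sqnormE !dotE (dotC d e) => ineq.
set x := dot e e in ineq *; set y := dot e d in ineq *; set z := dot d d in ineq *.
have -> : - t * (c^-1 * - y) + (2 * c)^-1 * z * t ^+ 2 =
    (2 * c)^-1 * (x + t * y + (t * y + t * (t * z))) - (2 * c)^-1 * x.
  by field; rewrite gt_eqF.
lra.
Qed.

End Euclidean.

(** * The anchored extragradient method *)

Section Anchored.
Context {R : realType} {n : nat}.
Implicit Types (u v w G H : 'rV[R]_n).

(** For the iterate of index t this is used with m = t + 1.  The anchoring
    weight 2 / (t + 3) = 2 / (m + 2) is the one for which the scalar products with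
    u - u0 telescope when monotonicity is multiplied by m (m + 1) (m + 2) / 2. *)
Definition potential (tau : R) (u0 : 'rV[R]_n) (m : nat) (G u : 'rV[R]_n) : R :=
  m%:R * m.+1%:R * m.+2%:R / 4 * tau * sqnorm G + m%:R * m.+1%:R * dot G (u - u0).

(** G and G' are the residuals at two successive iterates u and u', and H the
    one that drives the step, at the half point.  Put e = (m + 1) (m + 2).  The
    decrease of the potential, minus the monotonicity inequality with the weight
    m e / 2, is tau times
      (m e / 4) |G - H|^2 - e (m + 4) / 4 |G' - H|^2 + (e / 4) |G' - 2 H|^2,
    and 5 |G' - H|^2 <= |H - G|^2 makes this nonnegative, since
    (m + 4) / 5 <= m. *)
Lemma potential_step (tau : R) (m : nat) u0 u u' G G' H :
  0 < tau -> (0 < m)%N ->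
  u' = u + (2 / m.+2%:R) *: (u0 - u) - tau *: H ->
  0 <= dot (G' - G) (u' - u) ->
  5 * sqnorm (G' - H) <= sqnorm (H - G) ->
  potential tau u0 m.+1 G' u' <= potential tau u0 m G u.
Proof.
move=> tau0 m0 u'E mono lip; rewrite /potential.
have x1 : 1 <= m%:R :> R by rewrite ler1n.
set x : R := m%:R in x1 *.
have m1 : m.+1%:R = x + 1 :> R by rewrite -natr1.
have m2 : m.+2%:R = x + 2 :> R by rewrite -natr1 m1; ring.
have m3 : m.+3%:R = x + 3 :> R by rewrite -natr1 m2; ring.
rewrite m2 in u'E; rewrite m1 m2 m3.
have d2 : 0 < x + 2 by lra.
pose d := u - u0.
have e1 : u' - u = - (2 / (x + 2)) *: d - tau *: H.
  by rewrite u'E /d; apply/rowP => i; rewrite !mxE; ring.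
have e2 : u' - u0 = (x / (x + 2)) *: d - tau *: H.
  by rewrite u'E /d; apply/rowP => i; rewrite !mxE; field; rewrite gt_eqF.
rewrite e2 -/d; rewrite e1 in mono; clearbody d.
have sq := sqnorm_ge0 (G' - 2 *: H); have sq2 := sqnorm_ge0 (H - G).
move: mono lip sq sq2; rewrite !sqnormE !dotE (dotC H G') (dotC G H).
set gg := dot G G; set gg' := dot G' G'; set hh := dot H H.
set gh := dot H G; set gh' := dot G' H; set gd := dot G d; set gd' := dot G' d.
move=> mono lip sq sq2.
have mono' : 0 <= - (x * (x + 1)) * (gd' - gd)
    - x * (x + 1) * (x + 2) / 2 * tau * (gh' - gh).
  have -> : - (x * (x + 1)) * (gd' - gd)
      - x * (x + 1) * (x + 2) / 2 * tau * (gh' - gh) =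
    (x * (x + 1) * (x + 2) / 2) *
    (- (2 / (x + 2)) * gd' - tau * gh' - (- (2 / (x + 2)) * gd - tau * gh)).
    by field; rewrite gt_eqF.
  apply: mulr_ge0; last by lra.
  by apply: divr_ge0 => //; do 2?[apply: mulr_ge0]; lra.
pose e := (x + 1) * (x + 2).
have e0 : 0 <= e by rewrite mulr_ge0; lra.
have lip' : 0 <= tau * ((e * (x + 4) / 4) *
    (hh - 2 * gh + gg - 5 * (gg' - 2 * gh' + hh)) / 5).
  apply: mulr_ge0; first exact: ltW.
  apply: divr_ge0 => //; apply: mulr_ge0; last by lra.
  by apply: divr_ge0 => //; apply: mulr_ge0 => //; lra.
have sq' : 0 <= tau * (e / 4 * (gg' - 4 * gh' + 4 * hh)).
  apply: mulr_ge0; first exact: ltW.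
  by apply: mulr_ge0; [exact: divr_ge0|lra].
have sq2' : 0 <= tau * ((e * (x - 1) / 5) * (hh - 2 * gh + gg)).
  apply: mulr_ge0; first exact: ltW.
  apply: mulr_ge0; last by lra.
  by apply: divr_ge0 => //; apply: mulr_ge0 => //; lra.
have -> : (x + 1) * (x + 2) * (x / (x + 2) * gd' - tau * gh') =
  x * (x + 1) * gd' - tau * e * gh'.
  by rewrite /e; field; rewrite gt_eqF.
rewrite /e in lip' sq' sq2' *; lra.
Qed.

(** Let G be the residual A u_t + B_t and suppose that |u_t - v| < gam |G|.
    Monotonicity of B between the indices 0 and t bounds |u_0 - u_t|, and then
    tau |G_0|, by a multiple of gam |G|.  By the potential, |G|^2 (t + 1)^2 tau^2
    is at most of the order of
    tau^2 |G_0|^2 / (t + 1) + (t + 1) tau |G| |u_0 - u_t|,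
    which is impossible once tau (t + 1) is a large multiple of gam. *)
Lemma anchored_extragradient (tau gam : R) (A : 'rV[R]_n -> 'rV[R]_n)
    (u B : nat -> 'rV[R]_n) (v : 'rV[R]_n) :
  0 < tau -> tau <= gam / 2 ->
  (forall x y, 0 <= dot (A x - A y) (x - y)) ->
  (forall x y, 5 * (tau ^+ 2 * sqnorm (A x - A y)) <= sqnorm (x - y)) ->
  (forall s t, 0 <= dot (B s - B t) (u s - u t)) ->
  u 0%N = v - tau *: (A v + B 0%N) ->
  (forall t, let a := u t + (2 / t.+3%:R) *: (u 0%N - u t) in
     u t.+1 = a - tau *: (A (a - tau *: (A (u t) + B t)) + B t.+1)) ->
  forall t, 18 * gam <= tau * t.+1%:R ->
  gam ^+ 2 * sqnorm (A (u t) + B t) <= sqnorm (u t - v).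
Proof.
move=> tau0 taugam monoA lipA monoB uinit unext t tbig.
pose G s := A (u s) + B s.
have decr s : potential tau (u 0%N) s.+1 (G s) (u s) <=
              potential tau (u 0%N) 1 (G 0%N) (u 0%N).
  elim: s => // s; apply: le_trans.
  have := unext s; set a := _ + _; cbv zeta => us.
  apply: (potential_step tau0 _ us) => //.
    rewrite /G.
    have -> : A (u s.+1) + B s.+1 - (A (u s) + B s) =
      (A (u s.+1) - A (u s)) + (B s.+1 - B s) by rewrite opprD addrACA.
    by rewrite dotDl addr_ge0.
  set h := a - tau *: (A (u s) + B s) in us *; rewrite /G.
  have -> : A (u s.+1) + B s.+1 - (A h + B s.+1) = A (u s.+1) - A h.
    by rewrite opprD addrACA subrr addr0.
  have := lipA (u s.+1) h.
  have -> : u s.+1 - h = tau *: (A (u s) + B s - (A h + B s.+1)).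
    by rewrite us /h; apply/rowP => i; rewrite !mxE; ring.
  rewrite sqnormZ mulrCA ler_pM2l ?exprn_gt0// => /le_trans; apply.
  by rewrite -(sqnormN (_ + _ - _)) opprB.
have := decr t; rewrite /potential -/(G t) subrr.
have -> : t.+3%:R = t.+1%:R + 2 :> R by rewrite -natrD addn2.
have -> : t.+2%:R = t.+1%:R + 1 :> R by rewrite natr1.
rewrite dot0r mulr0 addr0 => dec.
rewrite leNgt; apply/negP => fail.
set g := sqnorm (G t) in fail dec *.
set e := sqnorm (u t - v) in fail *.
have x1 : 1 <= t.+1%:R :> R by rewrite ler1n.
set x : R := t.+1%:R in x1 dec tbig.
have g0 : 0 < gam ^+ 2 * g by apply: le_lt_trans fail; exact: sqnorm_ge0.
have gam0 : 0 < gam by lra.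
have tg : 4 * (tau ^+ 2 * g) <= gam ^+ 2 * g.
  have gp : 0 <= g by exact: sqnorm_ge0.
  by rewrite mulrA ler_wpM2r//; nra.
pose d := sqnorm (u 0%N - u t).
have dle : d <= 6 * (gam ^+ 2 * g).
  (* The resolvent of B is nonexpansive: u_0 and u_t are its values at points
     that differ by w. *)
  pose w := (v - u t) - tau *: (A v - A (u t)) - tau *: G t.
  have wE : tau *: (B 0%N - B t) = w - (u 0%N - u t).
    by rewrite uinit /w /G; apply/rowP => i; rewrite !mxE; ring.
  have : 0 <= dot (w - (u 0%N - u t)) (u 0%N - u t).
    by rewrite -wE dotZl mulr_ge0// ltW.
  rewrite dotDl dotNl -sqnormE -/d.
  have := dot_young w (u 0%N - u t) ltr01; rewrite invr1 !mul1r -/d.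
  have : sqnorm w <= 2 * (2 * e + 2 * (tau ^+ 2 * sqnorm (A v - A (u t))))
      + 2 * (tau ^+ 2 * g).
    apply: le_trans (sqnormB_le _ _) _; rewrite sqnormZ lerD2r ler_pM2l//.
    by apply: le_trans (sqnormB_le _ _) _; rewrite sqnormZ -sqnormN opprB.
  have := lipA v (u t); rewrite -(sqnormN (v - _)) opprB -/e.
  move: (dot _ _) => y; lra.
have vle : sqnorm (v - u 0%N) <= 14 * (gam ^+ 2 * g).
  have -> : v - u 0%N = - (u t - v) - (u 0%N - u t).
    by apply/rowP => i; rewrite !mxE; ring.
  apply: le_trans (sqnormB_le _ _) _; rewrite sqnormN -/e -/d; lra.
have g0le : tau ^+ 2 * sqnorm (G 0%N) <= 34 * (gam ^+ 2 * g).
  rewrite -sqnormZ.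
  have -> : tau *: G 0%N = tau *: (A (u 0%N) - A v) + (v - u 0%N).
    have -> : v - u 0%N = tau *: (A v + B 0%N) by rewrite uinit opprB addrC subrK.
    by rewrite /G; apply/rowP => i; rewrite !mxE; ring.
  apply: le_trans (sqnormD_le _ _) _; rewrite sqnormZ.
  have := lipA (u 0%N) v; rewrite -(sqnormN (u 0%N - v)) opprB; lra.
have x0 : 0 < x by lra.
(* This weight leaves at least half of the quadratic term of the potential. *)
have c0 : 0 < x * tau / 4 by rewrite divr_gt0// mulr_gt0.
have := dot_young (G t) (- (u t - u 0%N)) c0.
rewrite dotNr opprB -/d -/g invf_div; set y := dot _ _ in dec *.
move=> young.
have young' : - (x * tau ^+ 2 * g / 8 + 2 * d / x) <= tau * y.
  have : tau / 2 * (2 * - y) <= tau / 2 * (x * tau / 4 * g + 4 / (x * tau) * d).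
    by rewrite ler_wpM2l// divr_ge0// ltW.
  have -> : tau / 2 * (x * tau / 4 * g + 4 / (x * tau) * d) =
     x * tau ^+ 2 * g / 8 + 2 * d / x by field; rewrite !gt_eqF.
  move=> h; rewrite lerNl; apply: le_trans h; lra.
have dx : 2 * d / x <= 12 * (gam ^+ 2 * g) / x.
  by apply: ler_wpM2r; [rewrite invr_ge0 ltW|lra].
set T := tau ^+ 2 * g; set W := gam ^+ 2 * g in g0 dx g0le.
have T0 : 0 <= T by rewrite mulr_ge0 ?sqr_ge0// sqnorm_ge0.
have dec' : x * (x + 1) * (x + 2) / 4 * T + x * (x + 1) * (tau * y) <= 51 * W.
  have : tau * (x * (x + 1) * (x + 2) / 4 * tau * g + x * (x + 1) * y) <=
         tau * (1 * 2 * 3 / 4 * tau * sqnorm (G 0%N)) by rewrite ler_pM2l.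
  rewrite /T; lra.
have T2 : x ^+ 2 * T <= 304 * W.
  have : x * (x + 1) * - (x * T / 8 + 12 * W / x) <= x * (x + 1) * (tau * y).
    apply: ler_wpM2l; first by apply: mulr_ge0; lra.
    apply: le_trans young'; rewrite lerN2 /T mulrA. by rewrite lerD2l.
  have -> : x * (x + 1) * - (x * T / 8 + 12 * W / x) =
      - ((x + 1) * (x ^+ 2 * T / 8 + 12 * W)) by field; rewrite gt_eqF.
  have : 51 * W <= (x + 1) * (26 * W) by nra.
  have : 0 <= x * (x + 1) * T by apply: mulr_ge0 => //; apply: mulr_ge0; lra.
  move=> h1 h2 h3; have : (x + 1) * (x ^+ 2 * T) <= (x + 1) * (304 * W) by lra.
  by rewrite ler_pM2l//; lra.
have : (18 * gam) ^+ 2 <= (tau * x) ^+ 2.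
  by rewrite ler_sqr ?nnegrE// ?mulr_ge0//; lra.
move=> /(ler_wpM2r (sqnorm_ge0 (G t))); rewrite -/g.
move: g0 T2; rewrite /W /T; lra.
Qed.
End Anchored.

(** * Strongly convex-concave functions *)

Section Saddle.
Context {R : realType} {dx dy : nat}.
Context (mux muy L : R) (F : 'rV[R]_dx -> 'rV[R]_dy -> R).
Context (mux_gt0 : 0 < mux).
Context (muy_gt0 : 0 < muy).
Context (L_gt0 : 0 < L).
Context (dF : forall q : 'rV[R]_dx * 'rV[R]_dy,
  differentiable (fun q : 'rV[R]_dx * 'rV[R]_dy => F q.1 q.2) q).
Context (F_convex : forall y, strongly_convex mux (fun x => F x y)).
Context (F_concave : forall x, strongly_concave muy (F x)).
Context (F_smooth : smooth L F).

Let gx := grad_x F.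
Let gy := grad_y F.

Lemma differentiable_l x y : differentiable (fun u => F u y) x.
Proof.
apply: (@differentiable_comp _ _ _ _ (fun u => (u, y))
  (fun q : 'rV[R]_dx * 'rV[R]_dy => F q.1 q.2)); last exact: dF.
by apply: differentiable_pair.
Qed.

Lemma differentiable_r x y : differentiable (F x) y.
Proof.
apply: (@differentiable_comp _ _ _ _ (fun v => (x, v))
  (fun q : 'rV[R]_dx * 'rV[R]_dy => F q.1 q.2)); last exact: dF.
by apply: differentiable_pair.
Qed.

Lemma F_ge_tangent x x' y :
  F x y + dot (gx x y) (x' - x) + mux / 2 * sqnorm (x' - x) <= F x' y.
Proof. by apply: strongly_convex_grad => //; exact: differentiable_l. Qed.

Lemma F_le_tangent x y y' :
  F x y' <= F x y + dot (gy x y) (y' - y) - muy / 2 * sqnorm (y' - y).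
Proof.
have := @strongly_convex_grad _ _ muy (fun v => - F x v) y y'
  (differentiableN (differentiable_r x y)) (F_concave x).
have -> : grad (fun v => - F x v) y = - gy x y.
  apply/rowP => i; rewrite !mxE; apply: deriveN.
  exact: diff_derivable (differentiable_r x y).
by rewrite dotNl; lra.
Qed.

Lemma grad_xFhat x y : grad_x (Fhat F mux muy) x y = gx x y - mux *: x.
Proof.
rewrite /grad_x -scaleNr -(@grad_add_sqnorm _ _ _ _ (muy / 2 * sqnorm y)).
  by congr (grad _ _); apply/funext => u; rewrite /Fhat !mulNr.
exact: differentiable_l.
Qed.

Lemma grad_yFhat x y : grad_y (Fhat F mux muy) x y = gy x y + muy *: y.
Proof.
rewrite /grad_y -(@grad_add_sqnorm _ _ _ _ (- (mux / 2 * sqnorm x))).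
  by congr (grad _ _); apply/funext => v; rewrite /Fhat addrAC.
exact: differentiable_r.
Qed.

Lemma Fhat_ge_tangent x x' y :
  Fhat F mux muy x y + dot (grad_x (Fhat F mux muy) x y) (x' - x) <=
  Fhat F mux muy x' y.
Proof.
have := F_ge_tangent x x' y; rewrite grad_xFhat /Fhat !sqnormE !dotE (dotC x' x).
by lra.
Qed.

Lemma Fhat_le_tangent x y y' :
  Fhat F mux muy x y' <=
  Fhat F mux muy x y + dot (grad_y (Fhat F mux muy) x y) (y' - y).
Proof.
have := F_le_tangent x y y'; rewrite grad_yFhat /Fhat !sqnormE !dotE (dotC y' y).
by lra.
Qed.

(** The gradient of a mux-strongly convex function expands distances by at least
    mux, as is seen on a unit vector; this is where a positive dimension
    matters. *)
Lemma mux_le_L : (0 < dx)%N -> mux <= L.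
Proof.
move=> dx0; pose e : 'rV[R]_dx := delta_mx 0 (Ordinal dx0).
have e1 : sqnorm e = 1 by exact: sqnorm_delta.
have := F_ge_tangent 0 e 0; have := F_ge_tangent e 0 0.
rewrite subr0 sub0r sqnormN e1 dotNr => h1 h2.
have := F_smooth e 0 0 0; rewrite !subr0 e1 sqnorm0 addr0 mulr1.
have := sqnorm_ge0 (grad_y F e 0 - grad_y F 0 0) => h3 h4.
have := cauchy_schwarz (gx e 0 - gx 0 0) e; rewrite e1 mulr1 dotDl dotNl => h5.
have h6 : mux <= dot (gx e 0) e - dot (gx 0 0) e by lra.
have h7 : mux ^+ 2 <= (dot (gx e 0) e - dot (gx 0 0) e) ^+ 2.
  by rewrite ler_sqr ?nnegrE//; have := mux_gt0; lra.
have [m0 l0] := (ltW mux_gt0, ltW L_gt0).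
rewrite -ler_sqr ?nnegrE//; apply: le_trans h7 (le_trans h5 _).
by apply: le_trans h4; rewrite lerDl.
Qed.

Lemma saddle_monotone x1 x2 y1 y2 :
  mux * sqnorm (x1 - x2) + muy * sqnorm (y1 - y2) <=
  dot (gx x1 y1 - gx x2 y2) (x1 - x2) - dot (gy x1 y1 - gy x2 y2) (y1 - y2).
Proof.
have := F_ge_tangent x1 x2 y1; have := F_ge_tangent x2 x1 y2.
have := F_le_tangent x1 y1 y2; have := F_le_tangent x2 y2 y1.
rewrite -(opprB x1) -(opprB y1) !sqnormN !dotNr !dotDl !dotNl.
by lra.
Qed.

(** * The inner loop *)

Section Inner.
Context (r : 'rV[R]_dx -> \bar R) (g : 'rV[R]_dy -> \bar R).
Context (p : foam_params R).
Context (r_plc : proper_lsc_convex r).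
Context (g_plc : proper_lsc_convex g).
Context (dx_gt0 : (0 < dx)%N).
Context (theta_yE : theta_y p = 8 * mux^-1).
Context (gamma_xE : gamma_x p = 8 * mux^-1).
Context (gamma_yE : gamma_y p = theta_y p).
Context (lambdaE : lambda p = (2 * Num.sqrt 5 * (1 + 8 * L / mux))^-1).
Context (betaE : forall t, beta_ p t = 2 / t.+3%:R).

Let gam := 8 * mux^-1.
Let tau := gam * lambda p.

Lemma gam_gt0 : 0 < gam.
Proof. by rewrite mulr_gt0// invr_gt0. Qed.

Lemma lambda_gt0 : 0 < lambda p.
Proof.
rewrite lambdaE invr_gt0 !mulr_gt0 ?sqrtr_gt0//.
by rewrite addr_gt0// divr_gt0// mulr_gt0.
Qed.

Lemma tau_gt0 : 0 < tau.
Proof. by rewrite mulr_gt0 ?gam_gt0 ?lambda_gt0. Qed.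

Lemma sqr_sqrt5 : Num.sqrt (5 : R) ^+ 2 = 5.
Proof. by rewrite sqr_sqrtr. Qed.

Lemma sqrt5_bounds : 2 <= Num.sqrt (5 : R) <= 9 / 4.
Proof.
have h0 : 0 <= Num.sqrt (5 : R) by exact: sqrtr_ge0.
by have := sqr_sqrt5 => h; apply/andP; split; nra.
Qed.

Lemma lambda_le : lambda p <= 1 / 2.
Proof.
rewrite lambdaE div1r lef_pV2 ?posrE//.
  have /andP[h _] := sqrt5_bounds.
  have : 0 <= 8 * L / mux by rewrite divr_ge0 ?mulr_ge0 ?ltW.
  nra.
by rewrite -invr_gt0 -lambdaE lambda_gt0.
Qed.

(** The squared Lipschitz constant of the inner operator is at most
    5 / 2 L^2 ([operator_lipschitz]), so this is the step size condition
    tau^2 Lip^2 <= 1 / 5 of the anchored method. *)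
Lemma tau_lip : 5 * (tau ^+ 2 * (5 / 2 * L ^+ 2)) <= 1.
Proof.
have m0 := mux_gt0; have l0 := L_gt0.
have s0 : Num.sqrt 5 != 0 :> R by rewrite gt_eqF ?sqrtr_gt0.
have -> : tau = 4 / (Num.sqrt 5 * (mux + 8 * L)).
  rewrite /tau /gam lambdaE; field; rewrite s0 !gt_eqF//; lra.
rewrite expr_div_n exprMn sqr_sqrt5.
have d0 : 0 < mux + 8 * L by lra.
have -> : 5 * (4 ^+ 2 / (5 * (mux + 8 * L) ^+ 2) * (5 / 2 * L ^+ 2)) =
  40 * L ^+ 2 / (mux + 8 * L) ^+ 2 by field; rewrite gt_eqF.
by rewrite ler_pdivrMr ?exprn_gt0// mul1r; nra.
Qed.

Section Fixed.
Context (zg : 'rV[R]_dx) (yg : 'rV[R]_dy).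

Let ax := a_x F mux muy zg.
Let ay := a_y F mux muy p yg.
Let it := inner F r g mux muy p zg yg.

(* Since gamma_x = gamma_y, both blocks use the same step tau, and the pair of
   updates is a single one in the product space with its Euclidean norm. *)
Let A (w : 'rV[R]_(dx + dy)) : 'rV[R]_(dx + dy) :=
  row_mx (ax (lsubmx w) (rsubmx w)) (ay (lsubmx w) (rsubmx w)).

Lemma a_xB x1 x2 y1 y2 :
  ax x1 y1 - ax x2 y2 = gx x1 y1 - gx x2 y2 - (mux / 2) *: (x1 - x2).
Proof.
rewrite /ax /a_x !grad_xFhat; apply/rowP => i; rewrite !mxE; field.
by rewrite gt_eqF.
Qed.

Lemma a_yB x1 x2 y1 y2 :
  ay x1 y1 - ay x2 y2 = - (gy x1 y1 - gy x2 y2) + (mux / 8) *: (y1 - y2).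
Proof.
rewrite /ay /a_y !grad_yFhat theta_yE; apply/rowP => i; rewrite !mxE; field.
by rewrite gt_eqF.
Qed.

Lemma operator_monotone w1 w2 : 0 <= dot (A w1 - A w2) (w1 - w2).
Proof.
rewrite -[w1]hsubmxK -[w2]hsubmxK /A !row_mxKl !row_mxKr.
move: (lsubmx w1) (rsubmx w1) (lsubmx w2) (rsubmx w2) => x1 y1 x2 y2.
rewrite !opp_row_mx !add_row_mx dot_row_mx a_xB a_yB.
rewrite (dotDl _ _ (x1 - x2)) (dotDl _ _ (y1 - y2)) !dotNl !dotZl -!sqnormE.
have := saddle_monotone x1 x2 y1 y2.
have : 0 <= mux * sqnorm (x1 - x2) by rewrite mulr_ge0 ?sqnorm_ge0// ltW.
have : 0 <= mux * sqnorm (y1 - y2) by rewrite mulr_ge0 ?sqnorm_ge0// ltW.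
have : 0 <= muy * sqnorm (y1 - y2) by rewrite mulr_ge0 ?sqnorm_ge0// ltW.
lra.
Qed.

Lemma operator_lipschitz w1 w2 :
  5 * (tau ^+ 2 * sqnorm (A w1 - A w2)) <= sqnorm (w1 - w2).
Proof.
rewrite -[w1]hsubmxK -[w2]hsubmxK /A !row_mxKl !row_mxKr.
move: (lsubmx w1) (rsubmx w1) (lsubmx w2) (rsubmx w2) => x1 y1 x2 y2.
rewrite !opp_row_mx !add_row_mx !sqnorm_row_mx a_xB a_yB.
set nx := sqnorm (x1 - x2); set ny := sqnorm (y1 - y2).
have nx0 : 0 <= nx by exact: sqnorm_ge0.
have ny0 : 0 <= ny by exact: sqnorm_ge0.
have hx := sqnormB_le (gx x1 y1 - gx x2 y2) ((mux / 2) *: (x1 - x2)).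
have hy := sqnormD_le (- (gy x1 y1 - gy x2 y2)) ((mux / 8) *: (y1 - y2)).
rewrite sqnormZ -/nx in hx; rewrite sqnormZ sqnormN -/ny in hy.
have hs := F_smooth x1 x2 y1 y2; rewrite -/nx -/ny -/gx -/gy in hs.
have m2 : mux ^+ 2 <= L ^+ 2.
  have [m0 l0] := (ltW mux_gt0, ltW L_gt0).
  by rewrite ler_sqr ?nnegrE// mux_le_L.
have h1 : mux ^+ 2 * nx <= L ^+ 2 * nx by rewrite ler_wpM2r.
have h2 : mux ^+ 2 * ny <= L ^+ 2 * ny by rewrite ler_wpM2r.
have h3 : 0 <= L ^+ 2 * ny by rewrite mulr_ge0// sqr_ge0.
have hsum : sqnorm (gx x1 y1 - gx x2 y2 - (mux / 2) *: (x1 - x2)) +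
    sqnorm (- (gy x1 y1 - gy x2 y2) + (mux / 8) *: (y1 - y2)) <=
    5 / 2 * L ^+ 2 * (nx + ny) by lra.
move: (sqr_ge0 tau) tau_lip hsum; move: (tau ^+ 2) (_ + _) => T S T0 Tlip hsum.
have := ler_wpM2r (addr_ge0 nx0 ny0) Tlip.
by have := ler_wpM2l T0 hsum; lra.
Qed.

Lemma operator_row_mx x y : A (row_mx x y) = row_mx (ax x y) (ay x y).
Proof. by rewrite /A row_mxKl row_mxKr. Qed.

Lemma gamma_lambda_x : gamma_x p * lambda p = tau.
Proof. by rewrite gamma_xE. Qed.

Lemma gamma_lambda_y : gamma_y p * lambda p = tau.
Proof. by rewrite gamma_yE theta_yE. Qed.

(** The vectors b are defined so that the implicit step becomes an explicit one
    along A + b. *)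
Lemma prox_stepE s u v x y : s = prox_step F r g mux muy p zg yg u v x y ->
  row_mx (in_x s) (in_y s) =
  row_mx u v - tau *: (A (row_mx x y) + row_mx (in_bx s) (in_by s)).
Proof.
move=> ->.
have tau0 : tau != 0 by rewrite gt_eqF ?tau_gt0.
rewrite operator_row_mx add_row_mx scale_row_mx opp_row_mx add_row_mx.
rewrite /prox_step gamma_lambda_x gamma_lambda_y /= -/ax -/ay.
move: (ax x y) (ay x y) => a b; move: (prox _ _ _) (prox _ _ _) => x' y'.
by congr row_mx; apply/rowP => i; rewrite !mxE; field.
Qed.

Lemma inner_subgrad t :
  subgrad r (in_x (it t)) (in_bx (it t)) /\
  subgrad g (in_y (it t)) (in_by (it t)).
Proof.
have cx : 0 < gamma_x p * lambda p by rewrite gamma_xE tau_gt0.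
have cy : 0 < gamma_y p * lambda p by rewrite gamma_yE theta_yE tau_gt0.
by case: t => [|t]; split; exact: prox_subgrad.
Qed.

Lemma inner0E :
  row_mx (in_x (it 0)) (in_y (it 0)) =
  row_mx (x_start mux zg) (y_start yg) - tau *:
    (A (row_mx (x_start mux zg) (y_start yg)) +
     row_mx (in_bx (it 0)) (in_by (it 0))).
Proof. exact: prox_stepE. Qed.

Lemma innerSE t (a := row_mx
    (in_x (it t) + beta_ p t *: (in_x (it 0) - in_x (it t)))
    (in_y (it t) + beta_ p t *: (in_y (it 0) - in_y (it t)))) :
  row_mx (in_x (it t.+1)) (in_y (it t.+1)) =
  a - tau *: (A (a - tau *: (A (row_mx (in_x (it t)) (in_y (it t))) +
    row_mx (in_bx (it t)) (in_by (it t)))) +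
    row_mx (in_bx (it t.+1)) (in_by (it t.+1))).
Proof.
have half : a - tau *: (A (row_mx (in_x (it t)) (in_y (it t))) +
    row_mx (in_bx (it t)) (in_by (it t))) =
  row_mx
    (in_x (it t) + beta_ p t *: (in_x (it 0) - in_x (it t)) -
      (gamma_x p * lambda p) *: (ax (in_x (it t)) (in_y (it t)) + in_bx (it t)))
    (in_y (it t) + beta_ p t *: (in_y (it 0) - in_y (it t)) -
      (gamma_y p * lambda p) *: (ay (in_x (it t)) (in_y (it t)) + in_by (it t))).
  rewrite operator_row_mx add_row_mx scale_row_mx opp_row_mx add_row_mx.
  by rewrite gamma_lambda_x gamma_lambda_y.
by rewrite half; exact: prox_stepE.
Qed.

(** As gam / tau = 1 / lambda, this is the bound of [anchored_extragradient] on
    the number of steps. *)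
Lemma stop_test_late t : 18 <= lambda p * t.+1%:R ->
  stop_test F mux muy p zg yg (it t).
Proof.
move=> tbig.
pose u t := row_mx (in_x (it t)) (in_y (it t)).
pose B t := row_mx (in_bx (it t)) (in_by (it t)).
pose v := row_mx (x_start mux zg) (y_start yg).
have key : gam ^+ 2 * sqnorm (A (u t) + B t) <= sqnorm (u t - v).
  apply: (@anchored_extragradient _ _ tau gam A u B v).
  - exact: tau_gt0.
  - rewrite /tau ler_pM2l ?gam_gt0//; have := lambda_le; lra.
  - exact: operator_monotone.
  - exact: operator_lipschitz.
  - move=> s s'; rewrite /B /u !opp_row_mx !add_row_mx dot_row_mx.
    have [rs gs] := inner_subgrad s; have [rs' gs'] := inner_subgrad s'.
    by apply: addr_ge0; apply: subgrad_monotone; eassumption.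
  - exact: inner0E.
  - move=> s a.
    have -> : a = row_mx
        (in_x (it s) + beta_ p s *: (in_x (it 0) - in_x (it s)))
        (in_y (it s) + beta_ p s *: (in_y (it 0) - in_y (it s))).
      by rewrite /a /u opp_row_mx add_row_mx scale_row_mx add_row_mx betaE.
    exact: innerSE.
  - by rewrite [leLHS]mulrC -[leRHS]mulrA ler_pM2l ?gam_gt0.
move: key; rewrite /u /B /v operator_row_mx opp_row_mx !add_row_mx.
rewrite !sqnorm_row_mx /stop_test gamma_yE theta_yE gamma_xE -/gam -/ax -/ay.
rewrite -!mulrDr => key; rewrite -(ler_pM2l gam_gt0).
rewrite [leRHS]mulrA mulfV ?gt_eqF ?gam_gt0// mul1r.
by apply: le_trans key; rewrite expr2 -[leRHS]mulrA.
Qed.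

End Fixed.
End Inner.
End Saddle.

(** * The outer loop *)

(** One block (z or y) of the estimate for an accelerated step; m is the modulus
    of strong convexity of the block and gz the subgradient at the new point zf.
    It rests on the decomposition
      z - zs = (zf - zs) + (1 - alpha) / alpha (zf - zfo) + (zg - zf) / alpha
    for zg = alpha z + (1 - alpha) zfo. *)
Lemma momentum_step (R : realType) (n : nat) (alpha eta m theta : R)
    (z zf zfo zs gz : 'rV[R]_n) :
  0 < alpha -> 0 < eta -> 0 <= m -> 2 * (eta * m) <= 1 -> 2 * eta * alpha <= theta ->
  eta^-1 * sqnorm (z + (eta * m) *: (zf - z) - eta *: gz - zs) <=
  (eta^-1 - m) * sqnorm (z - zs)
  + (m * sqnorm (zf - zs) - 2 * dot gz (zf - zs))
  - 2 * ((1 - alpha) / alpha) * dot gz (zf - zfo)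
  - alpha^-1 * (2 * dot gz (alpha *: z + (1 - alpha) *: zfo - zf)
                - theta * sqnorm gz).
Proof.
move=> alpha0 eta0 m0 etam etaa.
pose a := z - zs; pose b := zf - zs; pose c := zfo - zs.
have -> : z + (eta * m) *: (zf - z) - eta *: gz - zs =
  a + eta *: (m *: (b - a) - gz) by apply/rowP => i; rewrite !mxE; ring.
have -> : zf - zfo = b - c by apply/rowP => i; rewrite !mxE; ring.
have -> : alpha *: z + (1 - alpha) *: zfo - zf = alpha *: a + (1 - alpha) *: c - b.
  by apply/rowP => i; rewrite !mxE; ring.
rewrite -/a -/b; clearbody a b c.
have key := sqnormB_le (m *: (b - a)) gz.
have expand e : eta^-1 * sqnorm (a + eta *: e) =
    eta^-1 * sqnorm a + 2 * dot a e + eta * sqnorm e.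
  by rewrite !sqnormE !dotE (dotC e a); field; rewrite gt_eqF.
rewrite expand; set e := m *: (b - a) - gz in key *.
have ekey : eta * sqnorm e <= m * sqnorm (b - a) + theta / alpha * sqnorm gz.
  apply: le_trans (ler_wpM2l (ltW eta0) key) _; rewrite mulrDr sqnormZ.
  apply: lerD.
    have := ler_wpM2r (mulr_ge0 m0 (sqnorm_ge0 (b - a))) etam.
    rewrite mul1r; apply: le_trans.
    by rewrite le_eqVlt; apply/orP; left; apply/eqP; ring.
  rewrite mulrA; apply: ler_wpM2r; first exact: sqnorm_ge0.
  by rewrite ler_pdivlMr//; lra.
have -> : 2 * ((1 - alpha) / alpha) * dot gz (b - c) =
  2 * (alpha^-1 - 1) * (dot gz b - dot gz c).
  by rewrite dotDr dotNr; field; rewrite gt_eqF.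
have -> : alpha^-1 * (2 * dot gz (alpha *: a + (1 - alpha) *: c - b) - theta * sqnorm gz)
  = 2 * dot gz a + 2 * (alpha^-1 - 1) * dot gz c - 2 * alpha^-1 * dot gz b
    - theta / alpha * sqnorm gz.
  by rewrite !dotE; field; rewrite gt_eqF.
apply: le_trans (lerD (lexx _) ekey) _.
rewrite /e !sqnormE !dotE (dotC a gz) (dotC b a).
by lra.
Qed.

Section Duality.
Context {R : realType} {dx dy : nat} (mux muy : R).
Context (Fh : 'rV[R]_dx -> 'rV[R]_dy -> R).
Context (r : 'rV[R]_dx -> \bar R) (g : 'rV[R]_dy -> \bar R).
Context (mux_gt0 : 0 < mux).
Context (Fh_ge : forall x x' y,
  Fh x y + dot (grad_x Fh x y) (x' - x) <= Fh x' y).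
Context (Fh_le : forall x y y',
  Fh x y' <= Fh x y + dot (grad_y Fh x y) (y' - y)).

(** The conditions under which x maximizes <x, z> - r x - Fh x y and (x, w) is a
    subgradient of the joint convex function G at (z, y). *)
Definition certified (x z : 'rV[R]_dx) (y w : 'rV[R]_dy) : Prop :=
  subgrad r x (z - grad_x Fh x y) /\ subgrad g y (w + grad_y Fh x y).

(** The value P(z, y), written with the maximizer x of a certified point. *)
Definition dual_value (x z : 'rV[R]_dx) (y : 'rV[R]_dy) : R :=
  dot x z - fine (r x) - Fh x y + fine (g y)
  + (2 * mux)^-1 * sqnorm z + muy / 2 * sqnorm y.

Lemma subgrad_fine n (h : 'rV[R]_n -> \bar R) u v b c :
  subgrad h u b -> subgrad h v c -> fine (h u) + dot b (v - u) <= fine (h v).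
Proof.
move=> [hu /(_ v) +] [hv _]; rewrite -{1}(fineK hu) -{1}(fineK hv).
by rewrite -EFinD lee_fin.
Qed.

(** The supremum in G(z', y') is bounded below by its value at x; convexity of g
    and concavity of Fh in y do the rest. *)
Lemma dual_value_ge x z y w x' z' y' w' :
  certified x z y w -> certified x' z' y' w' ->
  dual_value x z y + dot (x + mux^-1 *: z) (z' - z) + dot (w + muy *: y) (y' - y)
    + (2 * mux)^-1 * sqnorm (z' - z) + muy / 2 * sqnorm (y' - y)
  <= dual_value x' z' y'.
Proof.
move=> [cx cy] [cx' cy'].
have := subgrad_fine cx' cx; have := subgrad_fine cy cy'.
have := Fh_ge x' x y'; have := Fh_le x y y'.
rewrite /dual_value !sqnormE !dotE (dotC z z') (dotC y y').
rewrite invfM (dotC z' x) (dotC z' x').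
by lra.
Qed.
End Duality.

Section Outer.
Context {R : realType} {dx dy : nat}.
Context (mux muy : R) (F : 'rV[R]_dx -> 'rV[R]_dy -> R).
Context (r : 'rV[R]_dx -> \bar R) (g : 'rV[R]_dy -> \bar R).
Context (p : foam_params R).
Context (mux_gt0 : 0 < mux).
Context (muy_gt0 : 0 < muy).

Let Fh := Fhat F mux muy.

Context (Fh_ge : forall x x' y,
  Fh x y + dot (grad_x Fh x y) (x' - x) <= Fh x' y).
Context (Fh_le : forall x y y',
  Fh x y' <= Fh x y + dot (grad_y Fh x y) (y' - y)).
Context (theta_yE : theta_y p = 8 * mux^-1).
Context (alphaE : alpha p = Num.min 1 (Num.sqrt (theta_y p * muy))).
Context (gamma_xE : gamma_x p = 8 * mux^-1).
Context (gamma_yE : gamma_y p = theta_y p).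
Context (eta_zE : eta_z p = mux / 2).
Context (eta_yE :
  eta_y p = Num.min (2 * muy)^-1 (theta_y p / (2 * alpha p))).

Lemma theta_y_gt0 : 0 < theta_y p.
Proof. by rewrite theta_yE mulr_gt0// invr_gt0. Qed.

Lemma alpha_gt0 : 0 < alpha p.
Proof. by rewrite alphaE lt_min ltr01 sqrtr_gt0 mulr_gt0// theta_y_gt0. Qed.

Lemma alpha_le1 : alpha p <= 1.
Proof. by rewrite alphaE ge_min lexx. Qed.

Lemma alpha_sqr : alpha p ^+ 2 <= theta_y p * muy.
Proof.
have t0 : 0 <= theta_y p * muy by rewrite mulr_ge0 ?ltW ?theta_y_gt0.
rewrite -[leRHS]sqr_sqrtr// ler_sqr ?nnegrE ?sqrtr_ge0//; last exact: ltW alpha_gt0.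
by rewrite alphaE ge_min lexx orbT.
Qed.

Lemma eta_y_gt0 : 0 < eta_y p.
Proof.
have [a0 t0] := (alpha_gt0, theta_y_gt0).
by rewrite eta_yE lt_min invr_gt0 divr_gt0 ?mulr_gt0.
Qed.

(** Since alpha <= 1 and alpha^2 <= theta_y muy, both candidates for eta_y give
    the lower bound alpha / 2. *)
Lemma eta_y_muy : alpha p / 2 <= eta_y p * muy <= 1 / 2.
Proof.
have [a0 t0] := (alpha_gt0, theta_y_gt0).
have muy0 := muy_gt0; have := alpha_le1; have := alpha_sqr => asq a1.
have e1 : (2 * muy)^-1 * muy = 1 / 2 by field; rewrite gt_eqF.
apply/andP; split; last first.
  by rewrite -e1 ler_pM2r// eta_yE ge_min lexx.
rewrite eta_yE; case: (leP (2 * muy)^-1) => _; first by rewrite e1; lra.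
have -> : theta_y p / (2 * alpha p) * muy = (theta_y p * muy) / alpha p / 2.
  by field; rewrite gt_eqF.
by rewrite ler_pM2r// ler_pdivlMr// -expr2.
Qed.

Lemma eta_y_alpha : 2 * eta_y p * alpha p <= theta_y p.
Proof.
have a0 := alpha_gt0.
have : eta_y p <= theta_y p / (2 * alpha p) by rewrite eta_yE ge_min lexx orbT.
by rewrite ler_pdivlMr ?mulr_gt0//; lra.
Qed.

(** Here gz and gy are the components of the subgradient of P at the new point.
    The inequality is the one satisfied by a proximal step from (zg, yg) of
    length mux in z and theta_y in y.  In the z block, with
    b = (zf - zg) / mux, the test and the claim differ by
    mux (7/8 |gz|^2 + 9/4 <gz, b> + 15/8 |b|^2), which is nonnegative. *)
Lemma stop_test_descent zg yg i (xf := in_x i) (yf := in_y i)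
  (zf := grad_x Fh xf yf + in_bx i) (wf := - grad_y Fh xf yf + in_by i)
  (gz := xf + mux^-1 *: zf) (gy := wf + muy *: yf) :
  stop_test F mux muy p zg yg i ->
  0 <= (2 * dot gz (zg - zf) - mux * sqnorm gz)
     + (2 * dot gy (yg - yf) - theta_y p * sqnorm gy).
Proof.
pose b := mux^-1 *: (zf - zg); pose c := yf - yg.
have m0 : mux != 0 by rewrite gt_eqF.
rewrite /stop_test gamma_xE gamma_yE.
have -> : a_x F mux muy zg (in_x i) (in_y i) + in_bx i = (mux / 2) *: (gz + b).
  rewrite /a_x /gz /b /zf -/Fh -/xf -/yf; move: (grad_x Fh xf yf) => G.
  by apply/rowP => j; rewrite !mxE; field.
have -> : a_y F mux muy p yg (in_x i) (in_y i) + in_by i =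
    gy + (theta_y p)^-1 *: c.
  rewrite /a_y /gy /c /wf -/Fh -/xf -/yf; move: (grad_y Fh xf yf) => G.
  by apply/rowP => j; rewrite !mxE; ring.
have -> : in_x i - x_start mux zg = gz - b.
  rewrite /x_start /gz /b -/xf; move: (zf) => G.
  by apply/rowP => j; rewrite !mxE; field.
have -> : in_y i - y_start yg = c by [].
have -> : zg - zf = - (mux *: b).
  by rewrite /b scalerA mulfV// scale1r opprB.
have -> : yg - yf = - c by rewrite opprB.
clearbody b c gz gy; rewrite theta_yE sqnormZ.
have t0 : 8 / mux != 0 by rewrite gt_eqF// divr_gt0.
have -> : 8 * mux^-1 * ((mux / 2) ^+ 2 * sqnorm (gz + b)) = 2 * mux * sqnorm (gz + b).
  by field.
have -> : (8 * mux^-1)^-1 = mux / 8 by field; rewrite m0.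
have -> : 8 * mux^-1 * sqnorm (gy + (mux / 8) *: c) =
  8 / mux * sqnorm gy + 2 * dot gy c + mux / 8 * sqnorm c.
  by rewrite !sqnormE !dotE (dotC c gy); field.
have h1 := mulr_ge0 (ltW mux_gt0) (sqnorm_ge0 (gz + b)).
have h2 := mulr_ge0 (ltW mux_gt0) (sqnorm_ge0 gz).
have h3 := mulr_ge0 (ltW mux_gt0) (sqnorm_ge0 b).
have h4 := mulr_ge0 (ltW mux_gt0) (sqnorm_ge0 (3 *: gz + 5 *: b)).
move: h1 h2 h3 h4.
rewrite !sqnormE !dotE (dotC b gz).
by lra.
Qed.

Context (xs : 'rV[R]_dx) (ys : 'rV[R]_dy).
Let zs := - (mux *: xs).
Let ws := - (muy *: ys).
Context (star : certified Fh r g xs zs ys ws).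
Let val := dual_value mux muy Fh r g.

(** The subtracted term is the minimum of P, so that the function is nonnegative
    at certified states. *)
Definition lyapunov (s : outer_state R dx dy) (x : 'rV[R]_dx) : R :=
  (eta_z p)^-1 * sqnorm (out_z s - zs) + (eta_y p)^-1 * sqnorm (out_y s - ys)
  + 2 / alpha p * (val x (out_zf s) (out_yf s) - val xs zs ys).

Definition certified_state (s : outer_state R dx dy) (x : 'rV[R]_dx) : Prop :=
  exists w, certified Fh r g x (out_zf s) (out_yf s) w.

Lemma certified_outer_next s t
    (i := inner F r g mux muy p (z_g p s) (y_g p s) t) :
  subgrad r (in_x i) (in_bx i) -> subgrad g (in_y i) (in_by i) ->
  certified_state (outer_next F r g mux muy p s t) (in_x i).
Proof.
move=> rb gb; exists (- grad_y Fh (in_x i) (in_y i) + in_by i).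
by split; rewrite /= -/i addrAC ?subrr ?addNr add0r.
Qed.

Lemma val_ge_star x z y w : certified Fh r g x z y w -> val xs zs ys <= val x z y.
Proof.
move=> c; have := dual_value_ge mux muy Fh_ge Fh_le star c.
have -> : xs + mux^-1 *: zs = 0.
  by rewrite /zs scalerN scalerA mulVf ?gt_eqF// scale1r subrr.
have -> : ws + muy *: ys = 0 by rewrite /ws addNr.
rewrite !(dotC 0) !dot0r !addr0; apply: le_trans.
rewrite -addrA lerDl addr_ge0// mulr_ge0 ?sqnorm_ge0//.
  by rewrite invr_ge0 mulr_ge0 ?ltW.
by rewrite divr_ge0 ?ltW.
Qed.

Lemma lyapunov_ge s x : certified_state s x ->
  (eta_z p)^-1 * sqnorm (out_z s - zs) + (eta_y p)^-1 * sqnorm (out_y s - ys)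
  <= lyapunov s x.
Proof.
move=> [w c]; rewrite lerDl mulr_ge0 ?subr_ge0 ?(val_ge_star c)//.
by rewrite divr_ge0 ?ltW ?alpha_gt0.
Qed.

Lemma lyapunov_accurate s x : certified_state s x ->
  sqnorm (- (mux^-1 *: out_z s) - xs) + sqnorm (out_y s - ys) <=
  ((2 * mux)^-1 + eta_y p) * lyapunov s x.
Proof.
move=> cs; have ey0 := eta_y_gt0.
have c0 : 0 <= (2 * mux)^-1 by rewrite invr_ge0 mulr_ge0 ?ltW.
have m0 : mux != 0 by rewrite gt_eqF.
apply: le_trans (ler_wpM2l _ (lyapunov_ge cs)); last by rewrite addr_ge0 ?(ltW ey0).
have -> : sqnorm (- (mux^-1 *: out_z s) - xs) =
    mux^-1 ^+ 2 * sqnorm (out_z s - zs).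
  rewrite -sqnormZ -sqnormN /zs; congr sqnorm.
  by apply/rowP => i; rewrite !mxE; field.
have Z0 := sqnorm_ge0 (out_z s - zs); have Y0 := sqnorm_ge0 (out_y s - ys).
set Z := sqnorm (out_z s - zs) in Z0 *; set Y := sqnorm (out_y s - ys) in Y0 *.
have -> : mux^-1 ^+ 2 * Z = (2 * mux)^-1 * ((eta_z p)^-1 * Z).
  by rewrite eta_zE; field.
have ez0 : 0 <= (eta_z p)^-1 * Z.
  by apply: mulr_ge0 => //; rewrite eta_zE invf_div divr_ge0// ltW.
have ey1 : 0 <= (eta_y p)^-1 * Y.
  by apply: mulr_ge0 => //; rewrite invr_ge0 ltW.
rewrite [leRHS]mulrDl; apply: lerD; first by rewrite ler_wpM2l// lerDl.
rewrite -{1}[Y](mulVKf (_ : eta_y p != 0)) ?gt_eqF//.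
by rewrite ler_wpM2l ?(ltW ey0)// lerDr.
Qed.

(** Sum [momentum_step] over the two blocks.  The proximal inequality cancels
    the squared subgradients, and [dual_value_ge] towards the solution and
    towards the previous point turns the remaining scalar products into values
    of P.  The factor comes from eta_z / mux >= alpha / 2 and
    eta_y muy >= alpha / 2. *)
Lemma lyapunov_contraction s x t (i := inner F r g mux muy p (z_g p s) (y_g p s) t) :
  certified_state s x ->
  subgrad r (in_x i) (in_bx i) -> subgrad g (in_y i) (in_by i) ->
  stop_test F mux muy p (z_g p s) (y_g p s) i ->
  lyapunov (outer_next F r g mux muy p s t) (in_x i) <=
  (1 - alpha p / 2) * lyapunov s x.
Proof.
move=> [w co] rb gb test.
pose xf := in_x i; pose yf := in_y i.
pose zf := grad_x Fh xf yf + in_bx i; pose wf := - grad_y Fh xf yf + in_by i.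
have cf : certified Fh r g xf zf yf wf.
  by split; rewrite /zf /wf addrAC ?subrr ?addNr add0r.
have [a0 a1] := (alpha_gt0, alpha_le1).
have desc := stop_test_descent test; rewrite -/xf -/yf -/zf -/wf in desc.
have mz : 0 < mux^-1 by rewrite invr_gt0.
have m0 : mux != 0 by rewrite gt_eqF.
have := @momentum_step _ _ (alpha p) (eta_z p) mux^-1 mux (out_z s) zf (out_zf s)
   zs (xf + mux^-1 *: zf) a0 _ (ltW mz) _ _.
have := @momentum_step _ _ (alpha p) (eta_y p) muy (theta_y p) (out_y s) yf (out_yf s)
   ys (wf + muy *: yf) a0 eta_y_gt0 (ltW muy_gt0) _ eta_y_alpha.
have /andP[ylo yhi] := eta_y_muy.
have -> : 2 * (eta_y p * muy) <= 1 by lra.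
move=> /(_ isT) hy.
have -> : 0 < eta_z p by rewrite eta_zE divr_gt0.
have -> : 2 * (eta_z p / mux) <= 1.
  by rewrite eta_zE [leLHS](_ : _ = 1)//; field.
have -> : 2 * eta_z p * alpha p <= mux.
  rewrite eta_zE; have -> : 2 * (mux / 2) * alpha p = mux * alpha p by field.
  by rewrite ler_piMr// ltW.
move=> /(_ isT isT isT) hz.
have d1 := dual_value_ge mux muy Fh_ge Fh_le cf star.
have d2 := dual_value_ge mux muy Fh_ge Fh_le cf co.
have d3 := val_ge_star co.
rewrite -/(z_g p s) in hz; rewrite -/(y_g p s) in hy.
rewrite /lyapunov /= -/i -/xf -/yf -/Fh -/zf -/wf.
have flip (n : nat) (G u v : 'rV[R]_n) : dot G (u - v) = - dot G (v - u).
  by rewrite -dotNr opprB.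
have flipn (n : nat) (u v : 'rV[R]_n) : sqnorm (u - v) = sqnorm (v - u).
  by rewrite -sqnormN opprB.
rewrite (flip _ _ zs) (flip _ _ ys) (flipn _ zs) (flipn _ ys) in d1.
rewrite (flip _ _ (out_zf s)) (flip _ _ (out_yf s)) in d2.
have Z0 := sqnorm_ge0 (out_z s - zs); have Y0 := sqnorm_ge0 (out_y s - ys).
have C0 : 0 <= (2 * mux)^-1 * sqnorm (out_zf s - zf) +
                muy / 2 * sqnorm (out_yf s - yf).
  apply: addr_ge0; apply: mulr_ge0; rewrite ?sqnorm_ge0//.
    by rewrite invr_ge0 mulr_ge0 ?ltW.
  by rewrite divr_ge0 ?ltW.
have Zc : alpha p / 2 * ((eta_z p)^-1 * sqnorm (out_z s - zs)) <=
          mux^-1 * sqnorm (out_z s - zs).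
  rewrite mulrA; apply: ler_wpM2r => //; rewrite eta_zE invf_div.
  have -> : alpha p / 2 * (2 / mux) = alpha p * mux^-1 by field.
  by rewrite ler_piMl// ltW.
have Yc : alpha p / 2 * ((eta_y p)^-1 * sqnorm (out_y s - ys)) <=
          muy * sqnorm (out_y s - ys).
  rewrite mulrA; apply: ler_wpM2r => //.
  by rewrite ler_pdivrMr ?eta_y_gt0// [leRHS]mulrC.
have b1 : 1 <= (alpha p)^-1 by rewrite -invr1 lef_pV2 ?posrE.
have a00 : alpha p != 0 by rewrite gt_eqF.
have -> : (1 - alpha p / 2) * ((eta_z p)^-1 * sqnorm (out_z s - zs) +
    (eta_y p)^-1 * sqnorm (out_y s - ys) +
    2 / alpha p * (val x (out_zf s) (out_yf s) - val xs zs ys)) =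
  (eta_z p)^-1 * sqnorm (out_z s - zs) + (eta_y p)^-1 * sqnorm (out_y s - ys)
  - alpha p / 2 * ((eta_z p)^-1 * sqnorm (out_z s - zs))
  - alpha p / 2 * ((eta_y p)^-1 * sqnorm (out_y s - ys))
  + 2 * ((alpha p)^-1 - 1) * (val x (out_zf s) (out_yf s) - val xs zs ys)
  + (val x (out_zf s) (out_yf s) - val xs zs ys).
  have [ez ey] : eta_z p != 0 /\ eta_y p != 0.
    by rewrite eta_zE !gt_eqF ?divr_gt0 ?eta_y_gt0.
  by field; rewrite a00 ez ey.
have ba : (1 - alpha p) / alpha p = (alpha p)^-1 - 1 by field.
rewrite ba in hz hy.
have hd := ler_wpM2l (_ : 0 <= 2 * ((alpha p)^-1 - 1)) d2.
have {hd} := hd _; rewrite mulr_ge0 ?subr_ge0// => /(_ isT).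
have hdesc := mulr_ge0 (le_trans ler01 b1) desc.
have hC : 0 <= 2 * ((alpha p)^-1 - 1) * ((2 * mux)^-1 * sqnorm (out_zf s - zf) +
                muy / 2 * sqnorm (out_yf s - yf)).
  by apply: mulr_ge0 => //; rewrite mulr_ge0 ?subr_ge0.
have hm : (2 * mux)^-1 = mux^-1 / 2 by field.
rewrite hm in d1.
move: d1 d3 hz hy hdesc hC Zc Yc; rewrite /val.
move: (dual_value _ _ _ _ _ xf zf yf) (dual_value _ _ _ _ _ xs zs ys)
  (dual_value _ _ _ _ _ x _ _) => Pf Ps Pfo.
move: (dot _ (zf - zs)) (dot _ (yf - ys)) (dot _ (zf - out_zf s))
  (dot _ (yf - out_yf s)) (dot _ (z_g p s - zf)) (dot _ (y_g p s - yf))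
  (sqnorm _) (sqnorm _).
move=> *; lra.
Qed.
End Outer.

(** * First-order optimality of the minimax solution *)

Section Optimality.
Context {R : realType} {dx dy : nat}.
Context (mux muy L : R) (F : 'rV[R]_dx -> 'rV[R]_dy -> R).
Context (r : 'rV[R]_dx -> \bar R) (g : 'rV[R]_dy -> \bar R).
Context (mux_gt0 : 0 < mux).
Context (muy_gt0 : 0 < muy).
Context (L_gt0 : 0 < L).
Context (dF : forall q : 'rV[R]_dx * 'rV[R]_dy,
  differentiable (fun q : 'rV[R]_dx * 'rV[R]_dy => F q.1 q.2) q).
Context (F_convex : forall y, strongly_convex mux (fun x => F x y)).
Context (F_concave : forall x, strongly_concave muy (F x)).
Context (F_smooth : smooth L F).
Context (r_plc : proper_lsc_convex r).
Context (g_plc : proper_lsc_convex g).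

Let obj := objective F r g.

(** The proximal problem for g bounds g from below by -muy/4 |y|^2 up to a
    constant, which the strong concavity of F in y absorbs. *)
Lemma objective_sup_lty x : r x \is a fin_num ->
  (ereal_sup (range (obj x)) < +oo)%E.
Proof.
move=> rx; have muy40 : 0 < muy / 4 by rewrite divr_gt0.
have [u [gu umin]] := prox_exists 0 muy40 g_plc.
pose m := fine (g u) + muy / 4 * sqnorm (u - 0).
pose M := fine (r x) + F x 0 + muy^-1 * sqnorm (grad_y F x 0) - m.
apply: (@le_lt_trans _ _ M%:E); last exact: ltry.
apply: ge_ereal_sup => _ [y _ <-]; rewrite /obj /objective.
have := umin y; case: g_plc => -[gNy _] _ _.
rewrite -(fineK gu) -(fineK rx) subr0.
case: (g y) (gNy y) => [b||]// _; last by rewrite leNye.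
rewrite -!EFinD !lee_fin /= subr0 => gy; rewrite /M /m /= subr0.
have := F_le_tangent dF F_concave x 0 y; rewrite subr0.
have muy20 : 0 < muy / 2 by rewrite divr_gt0.
have := dot_young y (grad_y F x 0) muy20; rewrite (dotC y) invf_div.
by lra.
Qed.

Section Solution.
Context (xs : 'rV[R]_dx) (ys : 'rV[R]_dy).
Context (sol : minimax_solution F r g xs ys).

(** If r xs were +oo, the outer function would be +oo at its minimizer xs, but it
    is less than +oo on the domain of r. *)
Lemma solution_finite : r xs \is a fin_num /\ g ys \is a fin_num.
Proof.
have [xmin ymax] := sol.
have [[rNy [x1 rx1]] _ _] := r_plc; have [[gNy [y1 gy1]] _ _] := g_plc.
have rx1f : r x1 \is a fin_num by rewrite fin_numE rNy.
have gy1f : g y1 \is a fin_num by rewrite fin_numE gNy.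
have rxs : r xs \is a fin_num.
  have : (obj xs y1 < +oo)%E.
    have h : (obj xs y1 <= ereal_sup (range (obj xs)))%E.
      by apply: ereal_sup_ubound; exists y1.
    exact: (le_lt_trans (le_trans h (xmin x1)) (objective_sup_lty rx1f)).
  rewrite /obj /objective -(fineK gy1f) fin_numE rNy/= => h.
  by apply: contraTneq h => ->.
split => //; rewrite fin_numE gNy/=.
apply/eqP => gys; have := ymax y1; rewrite /objective gys.
by rewrite -(fineK gy1f) -(fineK rxs) -!EFinD.
Qed.

Lemma solution_subgrad_y : subgrad g ys (grad_y F xs ys).
Proof.
have [rxs gys] := solution_finite; have [[gNy _] _ gc] := g_plc.
have [_ ymax] := sol.
apply: subgrad_of_descent => // w gw.
exists ((L ^+ 2 + 1) / 2 * sqnorm (w - ys)); move: (w - ys) => d t /andP[t0 t1].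
have := ymax (ys + t *: d); rewrite /objective.
rewrite -(fineK rxs) -(fineK gys).
case: (g (ys + t *: d)) (gNy (ys + t *: d)) => [a||]// _; last first.
  by move=> _; rewrite addye// leey.
rewrite -!EFinN -!EFinD !lee_fin => opt.
have := F_le_tangent dF F_concave xs (ys + t *: d) ys.
have -> : ys - (ys + t *: d) = - (t *: d) by rewrite opprD addNKr.
rewrite sqnormN dotNr dotZr sqnormZ.
set e := grad_y F xs (ys + t *: d) => tang.
have lip : sqnorm (e - grad_y F xs ys) <= L ^+ 2 * (t ^+ 2 * sqnorm d).
  have := F_smooth xs xs (ys + t *: d) ys.
  rewrite subrr sqnorm0 add0r (_ : ys + t *: d - ys = t *: d); last first.
    by rewrite addrAC subrr add0r.
  by rewrite sqnormZ; apply: le_trans; rewrite lerDr sqnorm_ge0.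
set b := grad_y F xs ys in lip *; clearbody b e.
have := ler_wpM2l (ltW t0) (dot_young d (- (e - b)) t0).
rewrite sqnormN !dotE (dotC d e) (dotC d b) mulrDr (mulrA t t^-1) mulfV ?gt_eqF//.
have muyd : 0 <= muy / 2 * (t ^+ 2 * sqnorm d).
  by rewrite mulr_ge0 ?divr_ge0 ?mulr_ge0 ?sqr_ge0 ?sqnorm_ge0// ltW.
by rewrite /=; lra.
Qed.

(** Apart from the change of r, the objective on a segment issued from xs exceeds
    its value at (xs, ys) by at most the first-order change of F at y = ys,
    uniformly in y and up to a second-order term: moving y away
    from ys gains at most L t |d| |y - ys| and costs muy/2 |y - ys|^2.  No
    differentiability of the maximizer is involved. *)
Lemma objective_upper_bound (d : 'rV[R]_dx) (t : R) y :
  0 < t -> r (xs + t *: d) \is a fin_num ->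
  (obj (xs + t *: d)%R y <=
   (fine (r (xs + t *: d)) + F xs ys - fine (g ys) + t * dot (grad_x F xs ys) d
    + (muy / 2 + L ^+ 2 / (2 * muy)) * sqnorm d * t ^+ 2)%:E)%E.
Proof.
move=> t0 rt; have [_ gsub] := solution_subgrad_y; have := gsub y.
have [_ gys] := solution_finite; have [[gNy _] _ _] := g_plc.
rewrite /obj /objective -(fineK gys) -(fineK rt).
case: (g y) (gNy y) => [b||]// _; last by rewrite leNye.
rewrite -!EFinD !lee_fin /=.
have := F_le_tangent dF F_concave xs ys y.
have := F_ge_tangent dF F_convex (xs + t *: d) xs y.
rewrite opprD addNKr sqnormN dotNr dotZr sqnormZ.
set e := grad_x F (xs + t *: d) y; set q := sqnorm (y - ys).
have lip : sqnorm (e - grad_x F xs ys) <= L ^+ 2 * (t ^+ 2 * sqnorm d + q).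
  have := F_smooth (xs + t *: d) xs y ys.
  rewrite (_ : xs + t *: d - xs = t *: d); last by rewrite addrAC subrr add0r.
  by rewrite sqnormZ; apply: le_trans; rewrite lerDl sqnorm_ge0.
have c0 : 0 < muy / L ^+ 2 by rewrite divr_gt0 ?exprn_gt0.
have := dot_young (e - grad_x F xs ys) (t *: d) c0.
have := ler_wpM2l (ltW c0) lip.
rewrite [in X in X -> _]mulrA divfK ?gt_eqF ?exprn_gt0// invf_div dotZr sqnormZ.
rewrite dotDl dotNl.
have : 0 <= mux / 2 * (t ^+ 2 * sqnorm d).
  by rewrite mulr_ge0 ?divr_ge0 ?mulr_ge0 ?sqr_ge0 ?sqnorm_ge0// ltW.
have -> : L ^+ 2 / (2 * muy) = L ^+ 2 / muy / 2 by field; rewrite gt_eqF.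
lra.
Qed.

Lemma solution_subgrad_x : subgrad r xs (- grad_x F xs ys).
Proof.
have [rxs gys] := solution_finite; have [[rNy _] _ rc] := r_plc.
have [xmin _] := sol.
apply: subgrad_of_descent => // w rw; set d := w - xs.
exists ((muy / 2 + L ^+ 2 / (2 * muy)) * sqnorm d) => t /andP[t0 t1].
have [rt|] := boolP (r (xs + t *: d) \is a fin_num); last first.
  by rewrite fin_numE rNy/= negbK => /eqP ->; rewrite addye// leey.
have hsup : (obj xs ys <= ereal_sup (range (obj xs)))%E.
  by apply: ereal_sup_ubound; exists ys.
have := le_trans (le_trans hsup (xmin (xs + t *: d))) _.
move=> /(_ (fine (r (xs + t *: d)) + F xs ys - fine (g ys)
    + t * dot (grad_x F xs ys) d
    + (muy / 2 + L ^+ 2 / (2 * muy)) * sqnorm d * t ^+ 2)%:E).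
have ub : (ereal_sup (range (obj (xs + t *: d)%R)) <=
  (fine (r (xs + t *: d)) + F xs ys - fine (g ys) + t * dot (grad_x F xs ys) d
   + (muy / 2 + L ^+ 2 / (2 * muy)) * sqnorm d * t ^+ 2)%:E)%E.
  by apply: ge_ereal_sup => _ [y _ <-]; exact: objective_upper_bound.
move=> /(_ ub); rewrite /obj /objective -(fineK rxs) -(fineK gys) -(fineK rt).
by rewrite -!EFinD !lee_fin /= dotNl; lra.
Qed.

Lemma solution_certified :
  certified (Fhat F mux muy) r g xs (- (mux *: xs)) ys (- (muy *: ys)).
Proof.
split; first rewrite grad_xFhat// opprD opprK addrCA addNr addr0.
  exact: solution_subgrad_x.
by rewrite grad_yFhat// addrCA addNr addr0; exact: solution_subgrad_y.
Qed.
End Solution.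
End Optimality.

(** * Counting gradient evaluations *)

Section Complexity.
Context {R : realType} {dx dy : nat}.
Context (mux muy : R) (F : 'rV[R]_dx -> 'rV[R]_dy -> R).
Context (r : 'rV[R]_dx -> \bar R) (g : 'rV[R]_dy -> \bar R).
Context (p : foam_params R).

Lemma inner_stops T zg yg :
  stop_test F mux muy p zg yg (inner F r g mux muy p zg yg T) ->
  exists2 t, (t <= T)%N & inner_stops_at F r g mux muy p zg yg t.
Proof.
move=> stopT.
have ex : exists t, stop_test F mux muy p zg yg (inner F r g mux muy p zg yg t).
  by exists T.
case: (ex_minnP ex) => t stopt tmin; exists t; first exact: tmin.
by split=> // s st; apply: contraL st => /tmin; rewrite -leqNgt.
Qed.

(** The invariant ok s V reads: V bounds the Lyapunov function at s.  Its first
    value V is chosen after the first iteration, before the number of iterations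
    is. *)
Lemma run_exists (T : nat) (q : R) (ok : outer_state R dx dy -> R -> Prop) z0 y0 :
  0 <= q ->
  (forall zg yg, stop_test F mux muy p zg yg (inner F r g mux muy p zg yg T)) ->
  (forall s t, inner_stops_at F r g mux muy p (z_g p s) (y_g p s) t ->
     exists V, ok (outer_next F r g mux muy p s t) V) ->
  (forall s V t, ok s V -> inner_stops_at F r g mux muy p (z_g p s) (y_g p s) t ->
     ok (outer_next F r g mux muy p s t) (q * V)) ->
  exists V, forall m, exists s N,
    [/\ foam_run F r g mux muy p z0 y0 m.+1 s N, ok s (q ^+ m * V) &
        (N <= m.+1 * (2 * T).+2)%N].
Proof.
move=> q0 stopT ok1 okS.
have cost t : (t <= T)%N -> (outer_cost t <= (2 * T).+2)%N.
  by move=> tT; rewrite /outer_cost add1n !addSn !ltnS mul2n -addnn leq_add.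
pose s0 := OuterState z0 y0 z0 y0.
have [t0 t0T stop0] := inner_stops (stopT (z_g p s0) (y_g p s0)).
have [V okV] := ok1 _ _ stop0; exists V; elim=> [|m [s [N [run oks Nle]]]].
  exists (outer_next F r g mux muy p s0 t0), (0 + outer_cost t0)%N.
  split; last by rewrite add0n mul1n cost.
    by apply: foam_run_step => //; exact: foam_run_init.
  by rewrite expr0 mul1r.
have [t tT stopt] := inner_stops (stopT (z_g p s) (y_g p s)).
exists (outer_next F r g mux muy p s t), (N + outer_cost t)%N; split.
- exact: foam_run_step.
- by rewrite exprS -mulrA; exact: okS.
- by rewrite mulSn addnC leq_add// cost.
Qed.

End Complexity.

Lemma ln_ge_half (R : realType) (x : R) : 2 <= x -> 1 / 2 <= ln x.
Proof.
move=> x2; have x0 : 0 < x by lra.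
have := @le_ln1Dx R (x^-1 - 1).
rewrite (addrC 1) subrK lnV ?posrE// => h.
have xV : x^-1 <= 1 / 2 by rewrite div1r lef_pV2 ?posrE.
have : - ln x <= x^-1 - 1 by apply: h; rewrite ltrBDr addNr invr_gt0.
lra.
Qed.

Lemma geometric_le (R : realType) (q l : R) (m : nat) :
  0 <= q <= 1 -> l <= q * m%:R -> (1 - q) ^+ m <= expR (- l).
Proof.
move=> /andP[q0 q1] lm.
apply: (@le_trans _ _ (expR (- q) ^+ m)).
  by apply: lerXn2r; rewrite ?nnegrE ?expR_ge0 ?subr_ge0 ?expR_ge1Dx.
by rewrite -expRM_natr ler_expR mulNr lerN2.
Qed.

Lemma geometric_accuracy (R : realType) (q W C eps : R) (m : nat) :
  0 <= q <= 1 -> 0 < eps -> 0 < C -> W <= C -> ln (C / eps) <= q * m%:R ->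
  (1 - q) ^+ m * W <= eps.
Proof.
move=> q01 e0 C0 WC lm; have Ce : 0 < C / eps by rewrite divr_gt0.
have qm : 0 <= (1 - q) ^+ m by rewrite exprn_ge0// subr_ge0; case/andP: q01.
apply: le_trans (ler_wpM2l qm WC) _.
apply: le_trans (ler_wpM2r (ltW C0) (geometric_le q01 lm)) _.
by rewrite expRN lnK ?posrE// invf_div divfK// gt_eqF.
Qed.

(** As (mux a)^2 = 8 mux muy when a < 1, one has sqrt (mux muy) <= mux a. *)
Lemma ratio_le_max (R : realType) (mux muy L a : R) :
  0 < mux -> 0 < muy -> 0 < L -> a = Num.min 1 (Num.sqrt (8 * mux^-1 * muy)) ->
  L / mux / a <= Num.max (L / mux) (L / Num.sqrt (mux * muy)).
Proof.
move=> mux0 muy0 L0 ->; have tm : 0 < 8 * mux^-1 * muy by rewrite !mulr_gt0 ?invr_gt0.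
rewrite le_max; case: (leP 1 (Num.sqrt (8 * mux^-1 * muy))) => _.
  by rewrite divr1 lexx.
apply/orP; right; rewrite -mulrA -invfM ler_pM2l// lef_pV2 ?posrE; last first.
- by rewrite sqrtr_gt0 mulr_gt0.
- by rewrite mulr_gt0// sqrtr_gt0.
rewrite -[X in _ <= X * _]ger0_norm ?(ltW mux0)// -sqrtr_sqr -sqrtrM ?sqr_ge0//.
apply: ler_wsqrtr.
have -> : mux ^+ 2 * (8 / mux * muy) = 8 * (mux * muy) by field; rewrite gt_eqF.
by apply: ler_peMl; [rewrite mulr_ge0 ?ltW|rewrite ler1n].
Qed.

Lemma inner_budget (R : realType) (s t u : R) :
  1 <= u -> 2 <= s <= 9 / 4 -> t <= 18 * (2 * s * (1 + 8 * u)) ->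
  2 * t + 2 <= 20 * 80 * u.
Proof.
move=> u1 /andP[sl su] tle.
have : s * (1 + 8 * u) <= 9 / 4 * (9 * u) by apply: ler_pM; lra.
by lra.
Qed.

Lemma outer_budget (R : realType) (a l t : R) :
  1 <= a^-1 -> 1 / 2 <= l -> t <= 2 / a * l -> t + 2 <= 6 / a * l.
Proof.
move=> a1 l1 tle; have : 1 / 2 <= a^-1 * l by nra.
by lra.
Qed.

Theorem theorem3 (R : realType) :
  exists c : R, 0 < c /\
  forall (dx dy : nat) (mux muy L : R)
    (F : 'rV[R]_dx -> 'rV[R]_dy -> R)
    (r : 'rV[R]_dx -> \bar R) (g : 'rV[R]_dy -> \bar R)
    (xs : 'rV[R]_dx) (ys : 'rV[R]_dy)
    (p : foam_params R)
    (z0 : 'rV[R]_dx) (y0 : 'rV[R]_dy),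
  (0 < dx)%N -> (0 < dy)%N ->
  0 < mux -> 0 < muy -> 0 < L ->
  continuously_differentiable F ->
  (forall y, strongly_convex mux (fun x => F x y)) ->
  (forall x, strongly_concave muy (F x)) ->
  smooth L F ->
  proper_lsc_convex r -> proper_lsc_convex g ->
  minimax_solution F r g xs ys ->
  theta_y p = 8 * mux^-1 ->
  alpha p = Num.min 1 (Num.sqrt (theta_y p * muy)) ->
  lambda p = (2 * Num.sqrt 5 * (1 + 8 * L / mux))^-1 ->
  gamma_x p = 8 * mux^-1 ->
  gamma_y p = theta_y p ->
  eta_z p = mux / 2 ->
  eta_y p = Num.min (2 * muy)^-1 (theta_y p / (2 * alpha p)) ->
  (forall t : nat, beta_ p t = 2 / t.+3%:R) ->
  exists C : R, 2 <= C /\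
  forall eps : R, 0 < eps < 1 ->
  exists (K : nat) (s : outer_state R dx dy) (N : nat),
    [/\ (0 < K)%N,
        foam_run F r g mux muy p z0 y0 K s N,
        accurate xs ys eps (- (mux^-1 *: out_z s)) (out_y s) &
        N%:R <= c * Num.max (L / mux) (L / Num.sqrt (mux * muy))
                  * ln (C / eps)].
Proof.
(* At most (6 / alpha) log (C / eps) outer iterations, and at most 1600 L / mux
   gradient evaluations in each of them. *)
exists (6 * (20 * 80)); split; first by rewrite !mulr_gt0.
move=> dx dy mux muy L F r g xs ys p z0 y0 dx0 dy0 mux0 muy0 L0.
move=> [dF _ _] Fcvx Fccv Fsm rP gP sol thE alE laE gxE gyE ezE eyE beE.
have star := solution_certified mux0 muy0 L0 dF Fcvx Fccv Fsm rP gP sol.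
have Fge := Fhat_ge_tangent muy dF Fcvx.
have Fle := Fhat_le_tangent mux dF Fccv.
have mL := mux_le_L mux0 L0 dF Fcvx Fsm dx0.
have a0 := alpha_gt0 mux0 muy0 thE alE.
have a1 := alpha_le1 alE.
have l0 := lambda_gt0 mux0 L0 laE.
have isub := @inner_subgrad R dx dy mux muy L F mux0 L0 r g p rP gP thE gxE gyE laE.
pose T := Num.truncn (18 / lambda p).
have stopT zg yg : stop_test F mux muy p zg yg (inner F r g mux muy p zg yg T).
  apply: (stop_test_late mux0 muy0 L0 dF Fcvx Fccv Fsm rP gP dx0 thE gxE gyE laE beE).
  by rewrite mulrC -ler_pdivrMr// ltW// truncnS_gt.
pose ok s V := exists2 x, certified_state mux muy F r g s x &
   lyapunov mux muy F r g p xs ys s x <= V.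
have a2 : 0 <= alpha p / 2 <= 1 by move: a0 a1; clear; lra.
have q0 : 0 <= 1 - alpha p / 2 by rewrite subr_ge0; case/andP: a2.
have [||V runs] := @run_exists R dx dy mux muy F r g p T _ ok z0 y0 q0 stopT.
- move=> s t _.
  have [rb gb] := isub (z_g p s) (y_g p s) t.
  by eexists; eexists; [exact: certified_outer_next rb gb|exact: lexx].
- move=> s V t [x cx xV] [stop _].
  have [rb gb] := isub (z_g p s) (y_g p s) t.
  eexists; first exact: certified_outer_next rb gb.
  apply: le_trans (lyapunov_contraction mux0 muy0 Fge Fle thE alE gxE gyE ezE eyE
    star cx rb gb stop) _.
  exact: ler_wpM2l.
pose kappa := (2 * mux)^-1 + eta_y p.
have k0 : 0 <= kappa.
  by rewrite addr_ge0 ?invr_ge0 ?mulr_ge0 ?ltW// (eta_y_gt0 mux0 muy0 thE alE eyE).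
exists (Num.max 2 (kappa * V)); split; first by rewrite le_max lexx.
set C := Num.max 2 _; have C2 : 2 <= C by rewrite le_max lexx.
have C0 : 0 < C by exact: lt_le_trans C2.
have CV : kappa * V <= C by rewrite le_max lexx orbT.
move=> eps /andP[e0 e1]; pose l := ln (C / eps).
have lhalf : 1 / 2 <= l.
  apply: ln_ge_half; rewrite ler_pdivlMr//; apply: le_trans C2.
  by rewrite ger_pMr// ltW.
pose m := (Num.truncn (2 / alpha p * l)).+1.
have [s [N [run [x cx lyV] Nle]]] := runs m.
exists m.+1, s, N; split => //.
  apply: le_trans (lyapunov_accurate mux0 muy0 Fge Fle thE alE ezE eyE star cx) _.
  apply: le_trans (ler_wpM2l k0 lyV) _; rewrite mulrCA.
  apply: geometric_accuracy a2 e0 C0 CV _; rewrite -/l.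
  have := ltW (truncnS_gt (2 / alpha p * l)); rewrite -/m.
  have -> : 2 / alpha p * l = l / (alpha p / 2) by field; rewrite gt_eqF.
  by rewrite ler_pdivrMr ?divr_gt0// mulrC.
have u1 : 1 <= L / mux by rewrite ler_pdivlMr// mul1r.
have TE : T%:R <= 18 * (2 * Num.sqrt 5 * (1 + 8 * (L / mux))).
  have : T%:R <= 18 / lambda p by rewrite truncn_le divr_ge0 ?ltW.
  by rewrite laE invrK (_ : 8 * L / mux = 8 * (L / mux))// mulrA.
have TU : ((2 * T).+2)%:R <= 20 * 80 * (L / mux).
  by rewrite -addn2 natrD natrM; exact: inner_budget u1 (@sqrt5_bounds R) TE.
have aQ : L / mux / alpha p <= Num.max (L / mux) (L / Num.sqrt (mux * muy)).
  by apply: ratio_le_max => //; rewrite alE thE.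
have mE : m.+1%:R <= 6 / alpha p * l.
  have ai : 1 <= (alpha p)^-1 by rewrite -invr1 lef_pV2 ?posrE.
  have l0' : 0 <= l by apply: le_trans lhalf.
  have h : (Num.truncn (2 / alpha p * l))%:R <= 2 / alpha p * l.
    by rewrite truncn_le mulr_ge0 ?divr_ge0 ?(ltW a0).
  have -> : m.+1%:R = (Num.truncn (2 / alpha p * l))%:R + 2 :> R.
    by rewrite /m -addn2 natrD.
  exact: outer_budget ai lhalf h.
apply: (@le_trans _ _ (m.+1%:R * ((2 * T).+2)%:R)); first by rewrite -natrM ler_nat.
apply: (@le_trans _ _ (6 / alpha p * l * (20 * 80 * (L / mux)))).
  by apply: ler_pM.
have -> : 6 / alpha p * l * (20 * 80 * (L / mux)) =
    6 * (20 * 80) * (L / mux / alpha p) * l by ring.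
apply: ler_wpM2r; first by apply: le_trans lhalf.
by apply: ler_wpM2l; first exact: mulr_ge0.
Qed.
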